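(* Let $G$ and $H$ be countable discrete groups, acting canonically on their Stone–Čech compactifications $\beta G$ and $\beta H$. (i) The following are equivalent: (a) there is a coarse embedding $G\to H$; (b) there is an open, dense, $H$-invariant subspace $\tilde Y\subseteq\beta H$ such that $G\curvearrowright\beta G$ and $H\curvearrowright\tilde Y$ are Kakutani equivalent; (c) there is an open, dense, $H$-invariant subspace $\tilde Y\subseteq\beta H$ such that there is a continuous orbit couple for $G\curvearrowright\beta G$ and $H\curvearrowright\tilde Y$; (d) there is an open, dense, $H$-invariant subspace $\tilde Y\subseteq\beta H$ such that $G\curvearrowright\beta G$ and $H\curvearrowright\tilde Y$ are stably continuously orbit equivalent. (ii) There is a coarse equivalence $G\to H$ if and only if $\tilde Y=\beta H$ works in the statements (b), (c), (d); that is, the existence of a coarse equivalence $G\to H$ is equivalent to each of the statements (b), (c), (d) with $\tilde Y=\beta H$. (iii) There is a bijective coarse equivalence $G\to H$ if and only if $G\curvearrowright\beta G$ and $H\curvearrowright\beta H$ are continuously orbit equivalent.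
   Context: A map $\varphi: G\to H$ is a coarse map if it has finite point preimages and for every $S\subseteq G\times G$ with $\{st^{-1}:(s,t)\in S\}$ finite, $\{\varphi(s)\varphi(t)^{-1}:(s,t)\in S\}$ is finite. It is a coarse embedding if for every $S\subseteq G\times G$, $\{st^{-1}:(s,t)\in S\}$ is finite iff $\{\varphi(s)\varphi(t)^{-1}:(s,t)\in S\}$ is finite. Maps $\varphi,\phi$ are close ($\sim$) if $\{\varphi(x)\phi(x)^{-1}:x\in G\}$ is finite. A coarse map $\varphi$ is a coarse equivalence if there is a coarse map $\psi: H\to G$ with $\psi\circ\varphi\sim\mathrm{id}_G$, $\varphi\circ\psi\sim\mathrm{id}_H$. $\beta G$ is the Stone–Čech compactification of the discrete set $G$, with the action extending left multiplication of $G$ on itself. For actions by homeomorphisms $G\curvearrowright X$, $H\curvearrowright Y$ of discrete groups on locally compact Hausdorff spaces: a continuous orbit map $p: X\to Y$ is a continuous map for which there is a continuous $a: G\times X\to H$ with $p(g.x)=a(g,x).p(x)$. A continuous orbit couple consists of continuous orbit maps $p: X\to Y$, $q: Y\to X$ such that there are continuous $g: X\to G$, $h: Y\to H$ with $q(p(x))=g(x).x$, $p(q(y))=h(y).y$ for all $x,y$. The systems are continuously orbit equivalent if there is such a couple with $p=q^{-1}$. They are stably continuously orbit equivalent if $\mathbb Z\times G\curvearrowright\mathbb Z\times X$ and $\mathbb Z\times H\curvearrowright\mathbb Z\times Y$ are continuously orbit equivalent, where $\mathbb Z$ acts on itself by translation. The transformation groupoid $X\rtimes G$ is $X\times G$ with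 $r(x,g)=x$, $s(x,g)=g^{-1}.x$, $(x,g)(g^{-1}.x,g')=(x,gg')$, and $(X\rtimes G)|A=s^{-1}(A)\cap r^{-1}(A)$. The systems are Kakutani equivalent if there are clopen $A\subseteq X$, $B\subseteq Y$ with $G.A=X$, $H.B=Y$ and $(X\rtimes G)|A\cong(Y\rtimes H)|B$ as topological groupoids. *)

(* Defs.v *)
From HB Require Import structures.
From mathcomp Require Import all_boot all_order all_algebra.
From mathcomp Require Import boolp classical_sets functions cardinality.
From mathcomp Require Import topology separation_axioms.

Set Implicit Arguments.
Unset Strict Implicit.
Unset Printing Implicit Defensive.

Local Open Scope classical_set_scope.
Local Open Scope group_scope.

Section Coarse.
Context {G H : groupType}.
Implicit Types (phi : G -> H) (S : set (G * G)).

Definition differences S : set G := [set st.1 * st.2^-1 | st in S].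

Definition image_differences phi S : set H :=
  [set phi st.1 * (phi st.2)^-1 | st in S].

Definition coarse_map phi :=
  (forall y, finite_set (phi @^-1` [set y])) /\
  forall S, finite_set (differences S) -> finite_set (image_differences phi S).

Definition coarse_embedding phi :=
  forall S, finite_set (differences S) <-> finite_set (image_differences phi S).

Definition close_maps phi phi' :=
  finite_set [set phi x * (phi' x)^-1 | x in [set: G]].

End Coarse.

Definition coarse_equivalence (G H : groupType) (phi : G -> H) :=
  coarse_map phi /\
  exists psi : H -> G, [/\ coarse_map psi, close_maps (psi \o phi) idfun &
                           close_maps (phi \o psi) idfun].

(* The points are the ultrafilters on T; a base of the topology is given by the
   sets of all ultrafilters containing A, for A a subset of T. That this is
   indeed the Stone-Cech compactification is [stone_cech_universal] below. *)
Record stone_cech (T : Type) := StoneCech {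
  ultrafilter_of : set_system T;
  ultrafilterP : UltraFilter ultrafilter_of }.

#[global] Existing Instance ultrafilterP.

HB.instance Definition _ (T : Type) := gen_eqMixin (stone_cech T).
HB.instance Definition _ (T : Type) := gen_choiceMixin (stone_cech T).

Definition stone_cech_base (T : Type) (A : set T) : set (stone_cech T) :=
  [set u | ultrafilter_of u A].

Section StoneCechTopology.
Variable T : Type.

Let base_cover : \bigcup_(A in setT) @stone_cech_base T A = setT.
Proof.
by apply/seteqP; split=> // u _; exists setT => //; exact: filterT.
Qed.

Let base_join (A B : set T) (u : stone_cech T) : setT A -> setT B ->
  stone_cech_base A u -> stone_cech_base B u ->
  exists C, [/\ setT C, stone_cech_base C u &
                stone_cech_base C `<=` stone_cech_base A `&` stone_cech_base B].
Proof.
move=> _ _ uA uB; exists (A `&` B); split=> //; first exact: filterI.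
by move=> v vAB; split; apply: filterS vAB => t [].
Qed.

HB.instance Definition _ := @isBaseTopological.Build (stone_cech T)
  (set T) setT (@stone_cech_base T) base_cover base_join.

End StoneCechTopology.

Definition stone_cech_embed (T : Type) (t : T) : stone_cech T :=
  StoneCech (principal_filter_ultra t).

Lemma ultra_preimage (T U : Type) (f : T -> U) (F : set_system T) :
  UltraFilter F -> UltraFilter [set A | F (f @^-1` A)].
Proof.
move=> FU; split.
  by apply: fmap_proper_filter.
move=> K KF sFK; apply/seteqP; split; last exact: sFK.
move=> A KA; have [//|FA] := in_ultra_setVsetC (f @^-1` A) FU.
have KnA : K (~` A) by apply: sFK.
have /filter_ex[x []] // : K (A `&` ~` A) by exact: filterI.
Qed.

Definition stone_cech_map (T U : Type) (f : T -> U) (u : stone_cech T) :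
    stone_cech U :=
  StoneCech (ultra_preimage f (ultrafilterP u)).

Lemma stone_cech_eq (T : Type) (u v : stone_cech T) :
  ultrafilter_of u = ultrafilter_of v -> u = v.
Proof.
by case: u v => [F FU] [F' FU'] /= e; subst F'; rewrite (Prop_irrelevance FU FU').
Qed.

Lemma stone_cech_map_embed (T U : Type) (f : T -> U) (t : T) :
  stone_cech_map f (stone_cech_embed t) = stone_cech_embed (f t).
Proof.
apply: stone_cech_eq; apply/seteqP; split=> A /principal_filterP At;
exact/principal_filterP.
Qed.

Lemma stone_cech_base_open (T : Type) (A : set T) : open (stone_cech_base A).
Proof. by exists [set A] => //; rewrite bigcup_set1. Qed.

Lemma stone_cech_nbhsP (T : Type) (u : stone_cech T) (V : set (stone_cech T)) :
  nbhs u V <-> exists2 A, ultrafilter_of u A & stone_cech_base A `<=` V.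
Proof.
split=> [|[A uA AV]].
  rewrite nbhsE => -[W [[D _ <-] [A DA uA]] WV]; exists A => //.
  by move=> v vA; apply: WV; exists A.
by rewrite nbhsE; exists (stone_cech_base A) => //; split=> //;
  exact: stone_cech_base_open.
Qed.

Lemma stone_cech_map_continuous (T U : Type) (f : T -> U) :
  continuous (stone_cech_map f).
Proof.
move=> u V /stone_cech_nbhsP[A uA AV]; apply/stone_cech_nbhsP.
by exists (f @^-1` A) => // v vA; apply: AV.
Qed.

Lemma stone_cech_hausdorff (T : Type) : hausdorff_space (stone_cech T).
Proof.
move=> u v uv; apply: stone_cech_eq.
apply/esym/max_filter => A uA.
have [//|vA] := in_ultra_setVsetC A (ultrafilterP v).
have [||w [wA wcA]] := uv (stone_cech_base A) (stone_cech_base (~` A)).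
- by apply/stone_cech_nbhsP; exists A.
- by apply/stone_cech_nbhsP; exists (~` A).
- by have /filter_ex[x []] : ultrafilter_of w (A `&` ~` A) by exact: filterI.
Qed.

Lemma stone_cech_baseI (T : Type) (A B : set T) :
  stone_cech_base (A `&` B) = stone_cech_base A `&` stone_cech_base B.
Proof.
apply/seteqP; split=> [u uAB|u [uA uB]]; last exact: filterI.
by split; apply: filterS uAB => t [].
Qed.

Lemma stone_cech_baseC (T : Type) (A : set T) :
  stone_cech_base (~` A) = ~` stone_cech_base A.
Proof.
apply/seteqP; split=> [u uA uB|u uA].
  by have /filter_ex[x []] : ultrafilter_of u (A `&` ~` A) by exact: filterI.
by have [/uA|] := in_ultra_setVsetC A (ultrafilterP u).
Qed.

Lemma stone_cech_compact (T : Type) : compact [set: stone_cech T].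
Proof.
rewrite compact_ultra => F FU _.
have KP : ProperFilter [set A : set T | F (stone_cech_base A)].
  apply: Build_ProperFilter_ex.
    move=> A /= /filter_ex[u]; exact: filter_ex.
  split.
  - by apply: filterS (@filterT _ F _) => u _; exact: filterT.
  - move=> A B FA FB; change (F (stone_cech_base (A `&` B))).
    by rewrite stone_cech_baseI; exact: (@filterI _ F).
  - by move=> A B AB; apply: (@filterS _ F) => u; exact: filterS.
have KU : UltraFilter [set A : set T | F (stone_cech_base A)].
  split=> // K PK sFK; apply/seteqP; split=> // A KA /=.
  have [//|] := in_ultra_setVsetC (stone_cech_base A) FU.
  rewrite -stone_cech_baseC => /sFK KnA.
  by have /filter_ex[x []] : K (A `&` ~` A) by exact: filterI.
exists (StoneCech KU); split=> // V /stone_cech_nbhsP[A FA AV].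
exact: (@filterS _ F _ _ _ AV).
Qed.

Lemma stone_cech_embed_dense (T : Type) : dense (range (@stone_cech_embed T)).
Proof.
move=> O [u Ou] oO.
have /stone_cech_nbhsP[A uA AO] : nbhs u O by exact: open_nbhs_nbhs.
have /filter_ex[t At] := uA.
by exists (stone_cech_embed t); split; [apply/AO/principal_filterP|exists t].
Qed.

Lemma stone_cech_universal (T : Type) (K : topologicalType) (f : T -> K) :
  hausdorff_space K -> compact [set: K] ->
  exists! F : stone_cech T -> K,
    continuous F /\ forall t, F (stone_cech_embed t) = f t.
Proof.
move=> hK cK.
have /choice[F FP] (u : stone_cech T) :
    exists k : K, forall A, nbhs k A -> ultrafilter_of u (f @^-1` A).
  have fU := ultra_preimage f (ultrafilterP u).
  move: cK; rewrite compact_ultra => /(_ _ fU)[|k [_ uk]].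
    exact: filterT.
  by exists k.
exists F; split; first split.
- move=> u V FuV.
  have [W FuW WV] := @compact_regular K (F u) setT hK cK filterT V FuV.
  apply/stone_cech_nbhsP; exists (f @^-1` W); first exact: FP.
  move=> v vW; apply: WV => B FvB.
  have := FP v _ FvB => /= vB.
  by have /filter_ex[t []] : ultrafilter_of v (f @^-1` W `&` f @^-1` B)
    by [exact: filterI|]; exists (f t).
- move=> t; apply: hK => A B FA fB.
  have /principal_filterP At := FP _ _ FA.
  by exists (f t); split=> //; exact: nbhs_singleton.
- move=> F' [cF' F'f]; apply/funext => u; apply: hK => A B FA FB.
  have uA := FP u _ FA.
  have /stone_cech_nbhsP[C uC CB] := cF' u _ FB.
  have /filter_ex[t [/= At Ct]] : ultrafilter_of u (f @^-1` A `&` C)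
    by exact: filterI.
  exists (f t); split=> //; rewrite -F'f; apply: CB; exact/principal_filterP.
Qed.

Lemma locally_compactTP (X : topologicalType) :
  locally_compact [set: X] <->
  forall x : X, exists2 U, nbhs x U & compact U /\ closed U.
Proof.
split=> lcX x.
  have [U xU cU] := lcX x I; exists U => //.
  by apply: (@filterS _ (nbhs x) _ _ _ _ xU) => y; apply.
move=> _; have [U xU cU] := lcX x; exists U => //.
by apply: (@filterS _ (nbhs x) _ _ _ _ xU).
Qed.

Record dynamical_system (G : groupType) := DynamicalSystem {
  space :> topologicalType;
  act : G -> space -> space;
  act1g : forall x, act 1 x = x;
  actMg : forall g h x, act (g * h) x = act g (act h x);
  act_continuous : forall g, continuous (act g);
  space_hausdorff : hausdorff_space space;
  space_locally_compact : locally_compact [set: space] }.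

Arguments act {G d} g x.

Section StoneCechSystem.
Variable G : groupType.

Let act (g : G) : stone_cech G -> stone_cech G := stone_cech_map (fun h => g * h).

Let act_mul1 u : act 1 u = u.
Proof.
apply: stone_cech_eq => /=; apply/funext => A; congr (ultrafilter_of u _).
by apply/seteqP; split=> h /=; rewrite mul1g.
Qed.

Let act_mul g h u : act (g * h) u = act g (act h u).
Proof.
apply: stone_cech_eq => /=; apply/funext => A; congr (ultrafilter_of u _).
by apply/seteqP; split=> k /=; rewrite mulgA.
Qed.

Let stone_cech_lc : locally_compact [set: stone_cech G].
Proof.
apply/locally_compactTP => u; exists setT; first exact: filterT.
by split; [exact: stone_cech_compact|exact: closedT].
Qed.

Definition stone_cech_system : dynamical_system G :=
  DynamicalSystem act_mul1 act_mul (fun g => @stone_cech_map_continuous _ _ _)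
    (@stone_cech_hausdorff G) stone_cech_lc.

End StoneCechSystem.

Lemma stone_cech_system_embed (G : groupType) (g h : G) :
  @act G (stone_cech_system G) g (stone_cech_embed h) = stone_cech_embed (g * h).
Proof. exact: stone_cech_map_embed. Qed.

Record invariant_open (G : groupType) (X : dynamical_system G) := InvariantOpen {
  invariant_set :> set X;
  invariant_open_open : open invariant_set;
  invariant_openP : forall g x, invariant_set x -> invariant_set (act g x) }.

Section Subtype.
Context {X Y : topologicalType}.

Lemma set_val_continuous (A : set X) : continuous (\val : A -> X).
Proof. exact: initial_continuous. Qed.

Lemma continuous_to_set (A : set X) (f : Y -> A) :
  continuous (\val \o f) -> continuous f.
Proof. exact: continuous_comp_initial. Qed.

Lemma set_type_hausdorff (A : set X) : hausdorff_space X -> hausdorff_space A.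
Proof.
move=> hX x y xy; apply/val_inj/hX => U V xU yV.
have [||z [zU zV]] := xy (\val @^-1` U) (\val @^-1` V).
- exact: set_val_continuous.
- exact: set_val_continuous.
- by exists (\val z).
Qed.

Lemma set_type_locally_compact (A : set X) : open A -> hausdorff_space X ->
  locally_compact [set: X] -> locally_compact [set: A].
Proof.
move=> oA hX /locally_compactTP lcX; apply/locally_compactTP => x.
have [K xK [cK clK]] := lcX (\val x).
have nA : nbhs (\val x) A by apply: open_nbhs_nbhs; split=> //; exact: set_valP.
have [W xW WAK] := @compact_regular _ (\val x) K hX cK xK _ (filterI nA xK).
have cW : compact (closure W).
  by apply: subclosed_compact cK _ => [|y /WAK[]//]; exact: closed_closure.
exists (\val @^-1` closure W).
  apply: set_val_continuous; apply: filterS xW; exact: subset_closure.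
split; last first.
  by apply: preimage_closed (@closed_closure _ _) => ? _; exact: set_val_continuous.
rewrite compact_ultra => F FU FW.
have := cW; rewrite compact_ultra => /(_ _ (ultra_preimage \val FU) FW).
move=> [y [Wy Fy]].
have Ay : A y by have [] := WAK y Wy.
exists (exist _ y (mem_set Ay)); split=> // V [_ [[O oO <-] Oy OV]].
by apply: (@filterS _ F _ _ _ OV); apply: Fy; exact: open_nbhs_nbhs.
Qed.

End Subtype.

Section SubSystem.
Variables (G : groupType) (X : dynamical_system G) (Y : invariant_open X).

Let sub_act (g : G) (y : Y) : Y :=
  exist _ (act g (\val y)) (mem_set (invariant_openP g (set_valP y))).

Let sub_act1 y : sub_act 1 y = y.
Proof. by apply: val_inj; exact: act1g. Qed.

Let sub_actM g h y : sub_act (g * h) y = sub_act g (sub_act h y).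
Proof. by apply: val_inj; exact: actMg. Qed.

Let sub_act_continuous g : continuous (sub_act g).
Proof.
apply: continuous_to_set => y; apply: continuous_comp.
  exact: set_val_continuous.
exact: act_continuous.
Qed.

Definition sub_system : dynamical_system G :=
  DynamicalSystem sub_act1 sub_actM sub_act_continuous
    (set_type_hausdorff (@space_hausdorff _ X))
    (set_type_locally_compact (invariant_open_open Y) (@space_hausdorff _ X)
       (@space_locally_compact _ X)).

End SubSystem.

Section ProductSystem.
Variables (G H : groupType) (X : dynamical_system G) (Y : dynamical_system H).

Let prod_act (gh : G * H) (xy : X * Y) : X * Y := (act gh.1 xy.1, act gh.2 xy.2).

Let prod_act1 xy : prod_act 1 xy = xy.
Proof. by case: xy => x y; rewrite /prod_act /= !act1g. Qed.

Let prod_actM g h xy : prod_act (g * h) xy = prod_act g (prod_act h xy).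
Proof. by rewrite /prod_act /= !actMg. Qed.

Let prod_act_continuous g : continuous (prod_act g).
Proof.
move=> xy; apply: cvg_pair => /=.
  by apply: continuous_comp; [exact: cvg_fst|exact: act_continuous].
by apply: continuous_comp; [exact: cvg_snd|exact: act_continuous].
Qed.

Let prod_hausdorff : hausdorff_space (X * Y)%type.
Proof.
move=> [x y] [x' y'] xy; congr pair; apply: space_hausdorff => U V xU xV.
  have [||[a b] [/= aU aV]] := xy (fst @^-1` U) (fst @^-1` V); last by exists a.
  - exact: (@cvg_fst _ _ (nbhs x) (nbhs y)).
  - exact: (@cvg_fst _ _ (nbhs x') (nbhs y')).
have [||[a b] [/= bU bV]] := xy (snd @^-1` U) (snd @^-1` V); last by exists b.
- exact: (@cvg_snd _ _ (nbhs x) (nbhs y)).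
- exact: (@cvg_snd _ _ (nbhs x') (nbhs y')).
Qed.

Let prod_locally_compact : locally_compact [set: (X * Y)%type].
Proof.
apply/locally_compactTP => -[x y].
have /locally_compactTP/(_ x)[U xU [cU clU]] := @space_locally_compact _ X.
have /locally_compactTP/(_ y)[V yV [cV clV]] := @space_locally_compact _ Y.
have cUV := compact_setX cU cV.
exists (U `*` V); first by exists (U, V).
by split=> //; apply: compact_closed cUV.
Qed.

Definition prod_system : dynamical_system (G * H)%type :=
  DynamicalSystem prod_act1 prod_actM prod_act_continuous
    prod_hausdorff prod_locally_compact.

End ProductSystem.

Definition integers : Type := int.
HB.instance Definition _ := Choice.on integers.
HB.instance Definition _ := @isGroup.Build integers
  (0 : int)%R (fun m : int => - m)%R (fun m n : int => m + n)%R
  (@GRing.addrA int) (@GRing.add0r int) (@GRing.addr0 int)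
  (@GRing.addNr int) (@GRing.addrN int).

Lemma discrete_continuous (X : discreteTopologicalType) (Y : topologicalType)
  (f : X -> Y) : continuous f.
Proof. by apply/continuousP => A _; exact: discrete_open. Qed.

Section TranslationSystem.
Variable G : groupType.

Let discrete_lc : locally_compact [set: discrete_topology G].
Proof.
apply/locally_compactTP => x; exists [set x]; first exact: discrete_set1.
by split; [exact: compact_set1|exact: discrete_closed].
Qed.

Definition translation_system : dynamical_system G :=
  @DynamicalSystem G (discrete_topology G) (fun g x => g * x) (@mul1g G)
    (fun g h x => esym (mulgA g h x)) (fun g => @discrete_continuous _ _ _)
    discrete_hausdorff discrete_lc.

End TranslationSystem.

Definition continuous_orbit_map (G H : groupType) (X : dynamical_system G)
    (Y : dynamical_system H) (p : X -> Y) :=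
  continuous p /\
  exists a : discrete_topology G * X -> discrete_topology H,
    continuous a /\ forall g x, p (act g x) = act (a (g, x)) (p x).

Section OrbitEquivalence.
Variables (G H : groupType) (X : dynamical_system G) (Y : dynamical_system H).

Definition is_continuous_orbit_couple (p : X -> Y) (q : Y -> X) :=
  [/\ continuous_orbit_map p, continuous_orbit_map q,
      exists g : X -> discrete_topology G,
        continuous g /\ forall x, q (p x) = act (g x) x &
      exists h : Y -> discrete_topology H,
        continuous h /\ forall y, p (q y) = act (h y) y].

Definition has_continuous_orbit_couple :=
  exists p q, is_continuous_orbit_couple p q.

Definition continuously_orbit_equivalent :=
  exists p q, [/\ is_continuous_orbit_couple p q, cancel p q & cancel q p].

End OrbitEquivalence.

Definition stabilization (G : groupType) (X : dynamical_system G) :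
    dynamical_system (integers * G)%type :=
  prod_system (translation_system integers) X.

Definition stably_continuously_orbit_equivalent (G H : groupType)
    (X : dynamical_system G) (Y : dynamical_system H) :=
  continuously_orbit_equivalent (stabilization X) (stabilization Y).

(* [gmul a b] is defined when the source of a is the range of b. *)
Record topological_groupoid := TopologicalGroupoid {
  objects : topologicalType;
  arrows :> topologicalType;
  gsrc : arrows -> objects;
  grng : arrows -> objects;
  gunit : objects -> arrows;
  ginv : arrows -> arrows;
  gmul : forall a b, gsrc a = grng b -> arrows;
  gsrc_unit : forall x, gsrc (gunit x) = x;
  grng_unit : forall x, grng (gunit x) = x;
  gsrc_inv : forall a, gsrc (ginv a) = grng a;
  grng_inv : forall a, grng (ginv a) = gsrc a;
  gsrc_mul : forall a b (e : gsrc a = grng b), gsrc (gmul e) = gsrc b;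
  grng_mul : forall a b (e : gsrc a = grng b), grng (gmul e) = grng a;
  gmulA : forall a b c (ab : gsrc a = grng b) (bc : gsrc b = grng c)
    (a_bc : gsrc a = grng (gmul bc)) (ab_c : gsrc (gmul ab) = grng c),
    gmul a_bc = gmul ab_c;
  gmul1 : forall a x (e : gsrc (gunit x) = grng a), gmul e = a;
  gmulr1 : forall a x (e : gsrc a = grng (gunit x)), gmul e = a;
  gmulV : forall a (e : gsrc (ginv a) = grng a), gmul e = gunit (gsrc a);
  gmulrV : forall a (e : gsrc a = grng (ginv a)), gmul e = gunit (grng a);
  gsrc_continuous : continuous gsrc;
  grng_continuous : continuous grng;
  gunit_continuous : continuous gunit;
  ginv_continuous : continuous ginv;
  gmul_continuous : continuous
    (fun ab : [set ab : arrows * arrows | gsrc ab.1 = grng ab.2] =>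
       gmul (set_valP ab)) }.

Definition homeomorphism (X Y : topologicalType) (f : X -> Y) :=
  continuous f /\ exists g, [/\ continuous g, cancel f g & cancel g f].

Definition groupoid_isomorphic (A B : topological_groupoid) :=
  exists (f : A -> B) (f0 : objects A -> objects B),
    [/\ homeomorphism f, homeomorphism f0,
        forall a, gsrc (f a) = f0 (gsrc a),
        forall a, grng (f a) = f0 (grng a) &
        forall a b (e : gsrc a = grng b) (e' : gsrc (f a) = grng (f b)),
          f (gmul e) = gmul e'].

Section ContinuityLemmas.

Lemma continuous_pair (X Y Z : topologicalType) (f : X -> Y) (g : X -> Z) :
  continuous f -> continuous g -> continuous (fun x => (f x, g x)).
Proof. by move=> cf cg x; apply: cvg_pair; [exact: cf|exact: cg]. Qed.

Lemma continuous_compT (X Y Z : topologicalType) (f : X -> Y) (g : Y -> Z) :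
  continuous f -> continuous g -> continuous (g \o f).
Proof. by move=> cf cg x; apply: continuous_comp; [exact: cf|exact: cg]. Qed.

Lemma fst_continuous (X Y : topologicalType) : continuous (@fst X Y).
Proof. by move=> [x y]; exact: cvg_fst. Qed.

Lemma snd_continuous (X Y : topologicalType) : continuous (@snd X Y).
Proof. by move=> [x y]; exact: cvg_snd. Qed.

Lemma continuous_uncurry_discrete (X Y : topologicalType)
    (D : discreteTopologicalType) (f : D -> X -> Y) :
  (forall d, continuous (f d)) -> continuous (fun xd : X * D => f xd.2 xd.1).
Proof.
move=> cf [x d] V /= /cf xV; exists (f d @^-1` V, [set d]) => /=.
  by split; [exact: xV|exact: discrete_set1].
by move=> [x' d'] /= [Vx' ->].
Qed.

End ContinuityLemmas.

Section TransformationGroupoid.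
Variables (G : groupType) (X : dynamical_system G).

Let arr : topologicalType := (X * discrete_topology G)%type.
Let src (a : arr) : X := act (a.2 : G)^-1 a.1.
Let rng (a : arr) : X := a.1.
Let unit (x : X) : arr := (x, 1 : G).
Let inv (a : arr) : arr := (act (a.2 : G)^-1 a.1, (a.2 : G)^-1).
Let mul (a b : arr) (_ : src a = rng b) : arr := (a.1, (a.2 : G) * (b.2 : G)).

Let src_unit x : src (unit x) = x.
Proof. by rewrite /src /= invg1 act1g. Qed.

Let src_inv a : src (inv a) = rng a.
Proof. by rewrite /src /= -actMg invgK mulgV act1g. Qed.

Let src_mul a b (e : src a = rng b) : src (mul e) = src b.
Proof. by rewrite /src /= invgM actMg -/(src a) e. Qed.

Let mulA a b c (ab : src a = rng b) (bc : src b = rng c)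
  (a_bc : src a = rng (mul bc)) (ab_c : src (mul ab) = rng c) :
  mul a_bc = mul ab_c.
Proof. by rewrite /mul /= mulgA. Qed.

Let mul1 a x (e : src (unit x) = rng a) : mul e = a.
Proof.
have := e; rewrite src_unit => xa; case: a e xa => y g e xy.
by rewrite /mul /= mul1g xy.
Qed.

Let mulr1 a x (e : src a = rng (unit x)) : mul e = a.
Proof. by case: a e => y g e; rewrite /mul /= mulg1. Qed.

Let mulV a (e : src (inv a) = rng a) : mul e = unit (src a).
Proof. by rewrite /mul /= mulVg. Qed.

Let mulrV a (e : src a = rng (inv a)) : mul e = unit (rng a).
Proof. by rewrite /mul /= mulgV. Qed.

Let src_continuous : continuous src.
Proof.
apply: (@continuous_uncurry_discrete X X (discrete_topology G)
  (fun g => act (g : G)^-1)) => g; exact: act_continuous.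
Qed.

Let rng_continuous : continuous rng.
Proof. exact: fst_continuous. Qed.

Let unit_continuous : continuous unit.
Proof. by apply: continuous_pair => x; [exact: cvg_id|exact: cvg_cst]. Qed.

Let inv_continuous : continuous inv.
Proof.
apply: continuous_pair; first exact: src_continuous.
by apply: continuous_compT; [exact: snd_continuous|exact: discrete_continuous].
Qed.

Let mul_continuous : continuous
  (fun ab : [set ab : arr * arr | src ab.1 = rng ab.2] => mul (set_valP ab)).
Proof.
have cval := @set_val_continuous _ [set ab : arr * arr | src ab.1 = rng ab.2].
have c1 := continuous_compT cval (@fst_continuous _ _).
have c2 := continuous_compT cval (@snd_continuous _ _).
apply: continuous_pair; first exact: continuous_compT c1 (@fst_continuous _ _).
apply: (continuous_compT (continuous_pair
  (continuous_compT c1 (@snd_continuous _ _))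
  (continuous_compT c2 (@snd_continuous _ _)))
  (@continuous_uncurry_discrete (discrete_topology G) (discrete_topology G)
     (discrete_topology G) (fun h g => (g : G) * (h : G)) _)).
by move=> h; exact: discrete_continuous.
Qed.

Definition transformation_groupoid : topological_groupoid :=
  @TopologicalGroupoid X arr src rng unit inv mul src_unit (fun=> erefl)
    src_inv (fun=> erefl) src_mul (fun _ _ _ => erefl) mulA mul1 mulr1 mulV mulrV
    src_continuous rng_continuous unit_continuous inv_continuous mul_continuous.

End TransformationGroupoid.

Section Restriction.
Variables (A : topological_groupoid) (U : set (objects A)).

Definition restriction_arrows : set A := @gsrc A @^-1` U `&` @grng A @^-1` U.

Let arr : topologicalType := restriction_arrows.
Let src (a : arr) : U :=
  exist _ (gsrc (\val a)) (mem_set (proj1 (set_valP a))).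
Let rng (a : arr) : U :=
  exist _ (grng (\val a)) (mem_set (proj2 (set_valP a))).

Let composable (a b : arr) (e : src a = rng b) : gsrc (\val a) = grng (\val b).
Proof. exact: (congr1 (\val : U -> objects A) e). Qed.

Let unit_in (x : U) : restriction_arrows (gunit (\val x)).
Proof. by split=> /=; rewrite ?gsrc_unit ?grng_unit; exact: set_valP. Qed.

Let inv_in (a : arr) : restriction_arrows (ginv (\val a)).
Proof.
by have [sa ra] := set_valP a; split=> /=; rewrite ?gsrc_inv ?grng_inv.
Qed.

Let mul_in (a b : arr) (e : src a = rng b) :
  restriction_arrows (gmul (composable e)).
Proof.
have [sa ra] := set_valP a; have [sb rb] := set_valP b.
by split=> /=; rewrite ?gsrc_mul ?grng_mul.
Qed.

Let unit (x : U) : arr := exist _ (gunit (\val x)) (mem_set (unit_in x)).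
Let inv (a : arr) : arr := exist _ (ginv (\val a)) (mem_set (inv_in a)).
Let mul (a b : arr) (e : src a = rng b) : arr :=
  exist _ (gmul (composable e)) (mem_set (mul_in e)).

Let src_unit x : src (unit x) = x.
Proof. exact/val_inj/gsrc_unit. Qed.

Let rng_unit x : rng (unit x) = x.
Proof. exact/val_inj/grng_unit. Qed.

Let src_inv a : src (inv a) = rng a.
Proof. exact/val_inj/gsrc_inv. Qed.

Let rng_inv a : rng (inv a) = src a.
Proof. exact/val_inj/grng_inv. Qed.

Let src_mul a b (e : src a = rng b) : src (mul e) = src b.
Proof. exact/val_inj/gsrc_mul. Qed.

Let rng_mul a b (e : src a = rng b) : rng (mul e) = rng a.
Proof. exact/val_inj/grng_mul. Qed.

Let mulA a b c (ab : src a = rng b) (bc : src b = rng c)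
  (a_bc : src a = rng (mul bc)) (ab_c : src (mul ab) = rng c) :
  mul a_bc = mul ab_c.
Proof. exact/val_inj/gmulA. Qed.

Let mul1 a x (e : src (unit x) = rng a) : mul e = a.
Proof. exact/val_inj/gmul1. Qed.

Let mulr1 a x (e : src a = rng (unit x)) : mul e = a.
Proof. exact/val_inj/gmulr1. Qed.

Let mulV a (e : src (inv a) = rng a) : mul e = unit (src a).
Proof. exact/val_inj/gmulV. Qed.

Let mulrV a (e : src a = rng (inv a)) : mul e = unit (rng a).
Proof. exact/val_inj/gmulrV. Qed.

Let src_continuous : continuous src.
Proof.
apply: continuous_to_set.
exact: continuous_compT (@set_val_continuous _ _) (@gsrc_continuous A).
Qed.

Let rng_continuous : continuous rng.
Proof.
apply: continuous_to_set.
exact: continuous_compT (@set_val_continuous _ _) (@grng_continuous A).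
Qed.

Let unit_continuous : continuous unit.
Proof.
apply: continuous_to_set.
exact: continuous_compT (@set_val_continuous _ _) (@gunit_continuous A).
Qed.

Let inv_continuous : continuous inv.
Proof.
apply: continuous_to_set.
exact: continuous_compT (@set_val_continuous _ _) (@ginv_continuous A).
Qed.

Let mul_continuous : continuous
  (fun ab : [set ab : arr * arr | src ab.1 = rng ab.2] => mul (set_valP ab)).
Proof.
apply: continuous_to_set.
have composable_in (ab : [set ab : arr * arr | src ab.1 = rng ab.2]) :
    [set ab : A * A | gsrc ab.1 = grng ab.2]
      (\val (\val ab).1, \val (\val ab).2).
  exact: composable (set_valP ab).
pose incl ab : [set ab : A * A | gsrc ab.1 = grng ab.2] :=
  SigSub (mem_set (composable_in ab)).
have cincl : continuous incl.
  apply: continuous_to_set.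
  have cval := @set_val_continuous _ [set ab : arr * arr | src ab.1 = rng ab.2].
  apply: continuous_pair.
    apply: continuous_compT (@set_val_continuous _ _).
    exact: continuous_compT cval (@fst_continuous _ _).
  apply: continuous_compT (@set_val_continuous _ _).
  exact: continuous_compT cval (@snd_continuous _ _).
rewrite (_ : _ \o _ = (fun ab => gmul (set_valP ab)) \o incl).
  exact: continuous_compT cincl (@gmul_continuous A).
by apply/funext => ab /=; congr gmul; exact: Prop_irrelevance.
Qed.

Definition groupoid_restriction : topological_groupoid :=
  @TopologicalGroupoid U arr src rng unit inv mul src_unit rng_unit
    src_inv rng_inv src_mul rng_mul mulA mul1 mulr1 mulV mulrV
    src_continuous rng_continuous unit_continuous inv_continuous mul_continuous.

End Restriction.

Definition kakutani_equivalent (G H : groupType) (X : dynamical_system G)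
    (Y : dynamical_system H) :=
  exists (A : set X) (B : set Y),
    [/\ clopen A, clopen B,
        \bigcup_(g : G) (act g @` A) = [set: X],
        \bigcup_(h : H) (act h @` B) = [set: Y] &
        groupoid_isomorphic
          (@groupoid_restriction (transformation_groupoid X) A)
          (@groupoid_restriction (transformation_groupoid Y) B)].

(* Main.v *)
Require Import Defs.
From mathcomp Require Import all_boot all_algebra.
From mathcomp Require Import boolp classical_sets functions cardinality.
From mathcomp Require Import topology.

(* A continuous orbit couple maps the isolated points, which form the dense
   orbits G and H, to isolated points, and every continuous map from a compact
   space to a discrete group has finite range; so the couple restricts to
   coarse maps G -> H and H -> G that are inverse up to finite error.
   Conversely, let phi be a coarse embedding and A a transversal of its fibres.
   Then phi restricts to a bijection from A to B = phi(G), and the limits along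
   ultrafilters of the functions t |-> phi(t) phi(g^-1 t)^-1, which have finite
   range, extend it to an isomorphism between the restrictions of the two
   transformation groupoids to the closures of A and B; there Y is the union of
   the translates of the closure of B. For arbitrary actions of countable
   groups, Kakutani equivalence implies stable orbit equivalence because Z * X
   is homeomorphic to N * A along orbits, and a stable orbit equivalence
   restricts to a couple on the slices {0} * X and {0} * Y. *)

Set Implicit Arguments.
Unset Strict Implicit.
Unset Printing Implicit Defensive.

Local Open Scope classical_set_scope.
Local Open Scope group_scope.

(** * Locally constant functions *)

(** This is continuity into a discrete space, stated for a bare type [D] so that no topology on [D]
    has to be named. *)
Definition locally_constant (T : topologicalType) (D : Type) (f : T -> D) :=
  forall t, \forall t' \near t, f t' = f t.

Section LocallyConstant.
Context {T : topologicalType}.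

Lemma locally_constantP (D : choiceType) (f : T -> D) :
  continuous (f : T -> discrete_topology D) <-> locally_constant f.
Proof.
split=> [cf t|lf t V fV].
  exact: (cf t [set f t] (@discrete_set1 (discrete_topology D) (f t))).
by apply: filterS (lf t) => t' /= ->; exact: (@nbhs_singleton (discrete_topology D)).
Qed.

Lemma locally_constant_cst (D : Type) (d : D) :
  locally_constant (fun _ : T => d).
Proof. by move=> t; exact: nearW. Qed.

Lemma locally_constant_comp (D E : Type) (F : D -> E) (f : T -> D) :
  locally_constant f -> locally_constant (F \o f).
Proof. by move=> lf t; apply: filterS (lf t) => t' /= ->. Qed.

Lemma locally_constant_comp2 (D1 D2 E : Type) (F : D1 -> D2 -> E)
    (f : T -> D1) (g : T -> D2) :
  locally_constant f -> locally_constant g ->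
  locally_constant (fun t => F (f t) (g t)).
Proof. by move=> lf lg t; apply: filterS2 (lf t) (lg t) => t' /= -> ->. Qed.

Lemma locally_constant_preimage (U : topologicalType) (D : Type)
    (f : U -> D) (s : T -> U) :
  continuous s -> locally_constant f -> locally_constant (f \o s).
Proof. by move=> cs lf t; exact: cs t _ (lf (s t)). Qed.

Lemma locally_constant_glue (U : topologicalType) (D : Type) (c : T -> D)
    (F : D -> T -> U) :
  locally_constant c -> (forall d, continuous (F d)) ->
  continuous (fun t => F (c t) t).
Proof.
move=> lc cF t V FV.
change (\forall t' \near t, V (F (c t') t')).
have cFV : \forall t' \near t, V (F (c t) t') := cF (c t) t V FV.
by apply: filterS2 cFV (lc t) => t' VF ->.
Qed.

Lemma locally_constant_lt (D : Type) (f : nat -> T -> D) n :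
  (forall i, locally_constant (f i)) ->
  forall t, \forall t' \near t, forall i, (i < n)%N -> f i t' = f i t.
Proof.
move=> lf t; elim: n => [|n IHn]; first exact: nearW.
apply: filterS2 IHn (lf n t) => t' IH e i; rewrite ltnS leq_eqVlt.
by case/orP => [/eqP->//|/IH].
Qed.

(* The value at [t] only involves the finitely many predicates [P i] with
   [i <= ex_minn (exP t)]. *)
Lemma locally_constant_ex_minn (P : T -> pred nat)
    (exP : forall t, exists i, P t i) :
  (forall i, locally_constant (P^~ i)) ->
  locally_constant (fun t => ex_minn (exP t)).
Proof.
move=> lP t; apply: filterS (locally_constant_lt (ex_minn (exP t)).+1 lP t).
move=> t' e; case: ex_minnP e => m Pm minm e; case: ex_minnP => m' Pm' minm'.
apply/eqP; rewrite eqn_leq; apply/andP; split.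
  by apply: minm'; rewrite e.
have [m'm|/ltnW//] := leqP m' m.
by apply: minm; rewrite -e.
Qed.

Lemma locally_constant_count (P : T -> pred nat) n :
  (forall i, locally_constant (P^~ i)) ->
  locally_constant (fun t => count (P t) (iota 0 n)).
Proof.
move=> lP t; apply: filterS (locally_constant_lt n lP t) => t' e.
by apply: eq_in_count => i; rewrite mem_iota => /e.
Qed.

Lemma locally_constant_clopen (A : set T) :
  clopen A -> locally_constant (fun t => `[< A t >]).
Proof.
move=> [oA cA] t; have [At|nAt] := pselect (A t).
  have : nbhs t A by exact: open_nbhs_nbhs.
  by apply: filterS => t' At'; rewrite !asboolT.
have : nbhs t (~` A) by apply: open_nbhs_nbhs; split=> //; exact: closed_openC.
by apply: filterS => t' At'; rewrite !asboolF.
Qed.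

Lemma compact_locally_constant (D : choiceType) (f : T -> D) :
  compact [set: T] -> locally_constant f -> finite_set (range f).
Proof.
move=> cT lf; apply: contrapT => infD.
(* The sets off which [f] takes finitely many values form a proper filter,
   which has no cluster point. *)
pose F : set_system T := [set A | finite_set (f @` ~` A)].
have FF : ProperFilter F.
  apply: Build_ProperFilter.
    by move=> /=; rewrite /F /= setC0.
  split; first by rewrite /F /= setCT image_set0.
  - by move=> A B FA FB; rewrite /F /= setCI image_setU finite_setU.
  - move=> A B AB; apply: sub_finite_set; apply: image_subset.
    exact: subsetC.
have [|t [_ Ft]] := cT F FF; first by rewrite /F /= setCT image_set0.
have [||t' [/= ne e]] := Ft (~` [set t' | f t' = f t]) [set t' | f t' = f t].
- rewrite /F /= setCK; apply: sub_finite_set (finite_set1 (f t)).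
  by move=> _ [t' e <-].
- exact: lf.
- exact: ne e.
Qed.

End LocallyConstant.

(** * Maps that agree up to a locally constant group element *)

(* All the conditions on orbit maps and couples are instances of this relation;
   see [orbit_mapP] and [orbit_coupleP]. *)
Definition orbit_close (T : topologicalType) (G : groupType)
    (X : dynamical_system G) (s s' : T -> X) :=
  exists2 c : T -> G, locally_constant c & forall t, s' t = act (c t) (s t).

Section OrbitClose.
Context {T : topologicalType} {G : groupType} {X : dynamical_system G}.
Implicit Types s : T -> X.

Lemma orbit_close_refl s : orbit_close s s.
Proof.
by exists (fun=> 1) => [|t]; [exact: locally_constant_cst|rewrite act1g].
Qed.

Lemma orbit_close_sym s s' : orbit_close s s' -> orbit_close s' s.
Proof.
move=> [c lc sc]; exists (fun t => (c t)^-1).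
  exact: (locally_constant_comp (fun g : G => g^-1)).
by move=> t; rewrite sc -actMg mulVg act1g.
Qed.

Lemma orbit_close_trans s s' s'' :
  orbit_close s s' -> orbit_close s' s'' -> orbit_close s s''.
Proof.
move=> [c lc sc] [c' lc' sc']; exists (fun t => c' t * c t).
  exact: locally_constant_comp2.
by move=> t; rewrite sc' sc actMg.
Qed.

Lemma orbit_close_act s c : locally_constant c ->
  orbit_close s (fun t => act (c t) (s t)).
Proof. by exists c. Qed.

Lemma orbit_close_comp (U : topologicalType) (f : U -> T) s s' :
  continuous f -> orbit_close s s' -> orbit_close (s \o f) (s' \o f).
Proof.
move=> cf [c lc sc]; exists (c \o f); first exact: locally_constant_preimage.
by move=> u /=; rewrite sc.
Qed.

Lemma act_orbit_continuous s (c : T -> G) : locally_constant c ->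
  continuous s -> continuous (fun t => act (c t) (s t)).
Proof.
move=> lc cs; apply: (locally_constant_glue (F := fun g t => act g (s t))) => //.
by move=> g; apply: continuous_compT cs _; exact: act_continuous.
Qed.

End OrbitClose.

Section OrbitMap.
Variables (G H : groupType) (X : dynamical_system G) (Y : dynamical_system H).

Lemma orbit_mapP (p : X -> Y) :
  continuous_orbit_map p <->
  continuous p /\ orbit_close (fun gx : discrete_topology G * X => p gx.2)
                              (fun gx => p (act (gx.1 : G) gx.2)).
Proof.
split=> [[cp [a [ca pa]]]|[cp [a la pa]]]; split=> //.
  by exists a => [|[g x]]; [exact/locally_constantP|exact: pa].
by exists a; split=> [|g x]; [exact/locally_constantP|exact: pa (g, x)].
Qed.

(** If [c] moves [s] to [s'], then the cocycle [a] of [p], evaluated at [(c t, s t)], moves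
    [p (s t)] to [p (s' t)]. *)
Lemma orbit_map_close (p : X -> Y) (T : topologicalType) (s s' : T -> X) :
  continuous_orbit_map p -> continuous s -> orbit_close s s' ->
  orbit_close (p \o s) (p \o s').
Proof.
move=> /orbit_mapP[_ [a la pa]] cs [c lc sc].
exists (fun t => a (c t, s t)) => [|t]; last by rewrite /= sc (pa (c t, s t)).
apply: (@locally_constant_preimage T (discrete_topology G * X)%type H a
  (fun t => (c t, s t))) la.
by apply: continuous_pair => //; exact/locally_constantP.
Qed.

Lemma orbit_coupleP (p : X -> Y) (q : Y -> X) :
  is_continuous_orbit_couple p q <->
  [/\ continuous_orbit_map p, continuous_orbit_map q,
      orbit_close id (q \o p) & orbit_close id (p \o q)].
Proof.
split=> -[op oq].
  move=> [g [cg qp]] [h [ch pq]].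
  by split=> //; [exists g|exists h] => //; exact/locally_constantP.
move=> [g lg qp] [h lh pq].
by split=> //; [exists g|exists h]; split=> //; exact/locally_constantP.
Qed.

End OrbitMap.

(** * From stable orbit equivalence to orbit couples *)

Section Stabilization.
Context {T : topologicalType} {G : groupType} {X : dynamical_system G}.

Lemma orbit_close_snd (s s' : T -> stabilization X) :
  orbit_close s s' -> orbit_close (snd \o s : T -> X) (snd \o s').
Proof.
move=> [c lc sc]; exists (fun t => (c t).2).
  exact: (locally_constant_comp snd).
by move=> t; rewrite /= sc.
Qed.

(** The integers act simply transitively on themselves, so the integer coordinates can always be
    matched by a locally constant translation. Only the coordinates in [X] carry a condition. *)
Lemma orbit_close_stab (s s' : T -> stabilization X) :
  continuous s -> continuous s' ->
  orbit_close (fun t => (s t).2 : X) (fun t => (s' t).2) -> orbit_close s s'.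
Proof.
move=> cs cs' [c lc sc].
have l1 (r : T -> stabilization X) : continuous r ->
    locally_constant (fun t => (r t).1 : integers).
  move=> cr; apply/locally_constantP.
  exact: continuous_compT cr (@fst_continuous _ _).
exists (fun t => (((s' t).1 : integers) * ((s t).1 : integers)^-1, c t)).
  apply: locally_constant_comp2 lc.
  by apply: (locally_constant_comp2 (fun m m' : integers => m * m'^-1)); exact: l1.
move=> t; rewrite [LHS]surjective_pairing sc.
by congr pair; rewrite /= -mulgA mulVg mulg1.
Qed.

Lemma continuous_stab (n : T -> integers) (s : T -> X) :
  locally_constant n -> continuous s ->
  continuous (fun t => (n t, s t) : stabilization X).
Proof. by move=> ln cs; apply: continuous_pair => //; exact/locally_constantP. Qed.

End Stabilization.

Section StableCouple.

(** Here [1] is the neutral element of the group [integers], that is, the integer 0. *)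
Definition zero_slice (G : groupType) (X : dynamical_system G) (x : X) :
  stabilization X := (1, x).

Let zero_slice_continuous (G : groupType) (X : dynamical_system G) :
  continuous (@zero_slice G X).
Proof.
by apply: (continuous_stab (n := fun=> 1)) => x //; exact: locally_constant_cst.
Qed.

Let zero_slice_snd_close (G : groupType) (X : dynamical_system G)
  (T : topologicalType) (s : T -> stabilization X) : continuous s ->
  orbit_close s (fun t => zero_slice (s t).2).
Proof.
move=> cs; apply: orbit_close_stab => //; last exact: orbit_close_refl.
apply: continuous_compT (@zero_slice_continuous G X).
exact: continuous_compT cs (@snd_continuous _ _).
Qed.

Let restrict_orbit_map (G H : groupType) (X : dynamical_system G)
  (Y : dynamical_system H) (p : stabilization X -> stabilization Y) :
  continuous_orbit_map p ->
  continuous_orbit_map (fun x : X => (p (zero_slice x)).2 : Y).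
Proof.
move=> op; apply/orbit_mapP; split.
  apply: continuous_compT (@snd_continuous _ _).
  by apply: continuous_compT (proj1 op); exact: zero_slice_continuous.
have csnd := @snd_continuous (discrete_topology G) X.
apply: (orbit_close_snd (s := fun gx : discrete_topology G * X =>
  p (zero_slice gx.2)) (s' := fun gx => p (zero_slice (act (gx.1 : G) gx.2)))).
have lfst : locally_constant (fst : discrete_topology G * X -> G).
  by apply/locally_constantP; exact: fst_continuous.
have cslice := continuous_compT csnd (@zero_slice_continuous G X).
apply: (orbit_map_close op cslice); apply: orbit_close_stab.
- exact: cslice.
- exact: continuous_compT (act_orbit_continuous lfst csnd)
    (@zero_slice_continuous G X).
- exact: (orbit_close_act (fun gx : discrete_topology G * X => gx.2)).
Qed.

Let restrict_close (G H : groupType) (X : dynamical_system G)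
  (Y : dynamical_system H) (p : stabilization X -> stabilization Y)
  (q : stabilization Y -> stabilization X) :
  continuous p -> continuous_orbit_map q -> orbit_close id (q \o p) ->
  orbit_close id (fun x : X => (q (zero_slice (p (zero_slice x)).2)).2).
Proof.
move=> cp oq qp.
have cpb := continuous_compT (@zero_slice_continuous G X) cp.
apply: (orbit_close_trans (s' := snd \o (q \o p \o @zero_slice G X))).
  apply: (orbit_close_snd (s := @zero_slice G X)).
  exact: (orbit_close_comp (@zero_slice_continuous _ _) qp).
apply: orbit_close_snd.
exact: orbit_map_close oq cpb (zero_slice_snd_close cpb).
Qed.

(** Replacing the integer coordinate of [p (zero_slice x)] by 0 moves the point only within its
    orbit, and [q] respects such moves. Hence the restricted maps still compose to the identity up
    to the action. *)
Lemma stable_orbit_couple (G H : groupType) (X : dynamical_system G)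
    (Y : dynamical_system H) :
  stably_continuously_orbit_equivalent X Y -> has_continuous_orbit_couple X Y.
Proof.
move=> [p [q [/orbit_coupleP[op oq qp pq] _ _]]].
exists (fun x => (p (zero_slice x)).2), (fun y => (q (zero_slice y)).2).
apply/orbit_coupleP; split; [exact: restrict_orbit_map..| |].
- exact: restrict_close (proj1 op) oq qp.
- exact: restrict_close (proj1 oq) op pq.
Qed.

End StableCouple.

(** * Controlled maps and coarse embeddings *)

Definition controlled (G H : groupType) (phi : G -> H) :=
  forall k, finite_set [set phi (k * t) * (phi t)^-1 | t in [set: G]].

(** A set of pairs with finitely many differences is contained in a finite union of the sets of
    pairs [(k * t, t)], so it suffices to test on these. *)
Lemma controlledP (G H : groupType) (phi : G -> H) :
  controlled phi <-> forall S, finite_set (differences S) ->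
    finite_set (image_differences phi S).
Proof.
split=> [cphi S fS|cphi k].
  pose D k := [set phi (k * t) * (phi t)^-1 | t in [set: G]].
  have fD : finite_set (\bigcup_(k in differences S) D k).
    by apply: bigcup_finite => // k _; exact: cphi.
  apply: sub_finite_set fD => _ [[s t] St <-] /=.
  exists (s * t^-1); first by exists (s, t).
  by exists t => //; rewrite mulgVK.
have := cphi [set (k * t, t) | t in [set: G]].
rewrite /image_differences image_comp; apply.
apply: sub_finite_set (finite_set1 k) => _ [_ [t _ <-] <-] /=.
by rewrite mulgK.
Qed.

Lemma close_finite_fibres (G H : groupType) (phi : G -> H) (psi : H -> G) :
  close_maps (psi \o phi) idfun ->
  forall y, finite_set (phi @^-1` [set y]).
Proof.
move=> fE y; apply: sub_finite_set (finite_image (fun e => e^-1 * psi y) fE).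
move=> t /= <-; exists (psi (phi t) * t^-1); first by exists t.
by rewrite invgM invgK mulgVK.
Qed.

Section Controlled.
Context {G H : groupType}.
Implicit Types (phi : G -> H) (psi : H -> G).

(** The map [psi] is controlled only along the image of [phi]. This is what a couple provides when
    only the space of [G] is compact. *)
Lemma coarse_embedding_retract phi psi : controlled phi ->
  (forall k, finite_set [set psi (k * phi t) * (psi (phi t))^-1 | t in setT]) ->
  close_maps (psi \o phi) idfun -> coarse_embedding phi.
Proof.
move=> cphi cpsi clo S; split; first by have /controlledP := cphi; exact.
move=> fS.
have fE : finite_set [set psi (phi t) * t^-1 | t in [set: G]] := clo.
pose D k := [set psi (k * phi t) * (psi (phi t))^-1 | t in [set: G]].
have fD : finite_set (\bigcup_(k in image_differences phi S) D k).
  by apply: bigcup_finite => // k _; exact: cpsi.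
(* With [s'] and [t'] for [psi (phi s)] and [psi (phi t)], the difference [s * t^-1] is the product
   of [(s' * s^-1)^-1], [s' * t'^-1] and [t' * t^-1], each from a finite set. *)
have := finite_image2 (fun x y => x * y)
  (finite_image2 (fun x y => x^-1 * y) fE fD) fE.
apply: sub_finite_set => _ [[s t] St <-] /=.
exists (s * (psi (phi s))^-1 * (psi (phi s) * (psi (phi t))^-1)).
  exists (psi (phi s) * s^-1); first by exists s.
  exists (psi (phi s) * (psi (phi t))^-1); last by rewrite invgM invgK.
  exists (phi s * (phi t)^-1); first by exists (s, t).
  by exists t => //; rewrite mulgVK.
exists (psi (phi t) * t^-1); first by exists t.
by rewrite -!mulgA mulKg mulKg.
Qed.

Lemma coarse_equivalence_embedding phi :
  coarse_equivalence phi -> coarse_embedding phi.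
Proof.
move=> [[_ /controlledP cphi] [psi [[_ /controlledP cpsi] psiphi _]]].
apply: (coarse_embedding_retract cphi) psiphi => k.
by apply: sub_finite_set (cpsi k) => _ [t _ <-]; exists (phi t).
Qed.

Lemma controlled_coarse_equivalence phi psi :
  controlled phi -> controlled psi -> close_maps (psi \o phi) idfun ->
  close_maps (phi \o psi) idfun -> coarse_equivalence phi.
Proof.
move=> cphi cpsi psiphi phipsi; split.
  by split; [exact: close_finite_fibres psiphi|exact/controlledP].
exists psi; split=> //.
by split; [exact: close_finite_fibres phipsi|exact/controlledP].
Qed.

End Controlled.

(** * Coarse maps from orbit couples *)

(** This is all that the passage from couples to coarse maps uses of the Stone-Čech compactification
    besides compactness. It covers its dense open invariant subspaces as well. *)
Definition dense_free_orbit (G : groupType) (X : dynamical_system G)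
    (e : G -> X) :=
  [/\ injective e, forall g h, act g (e h) = e (g * h),
      forall g, open [set e g] & dense (range e)].

Lemma stone_cech_embed_inj (T : Type) : injective (@stone_cech_embed T).
Proof.
move=> t t' e.
have /principal_filterP-> // : ultrafilter_of (stone_cech_embed t) [set t'].
by rewrite e; exact/principal_filterP.
Qed.

Lemma stone_cech_base1 (T : Type) (t : T) :
  stone_cech_base [set t] = [set stone_cech_embed t].
Proof.
apply/seteqP; split=> [u ut|_ ->]; last exact/principal_filterP.
apply/stone_cech_eq/max_filter => A /principal_filterP At.
by apply: filterS ut => _ ->.
Qed.

Lemma stone_cech_orbit (G : groupType) :
  @dense_free_orbit G (stone_cech_system G) (@stone_cech_embed G).
Proof.
split.
- exact: stone_cech_embed_inj.
- exact: stone_cech_system_embed.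
- by move=> g; rewrite -stone_cech_base1; exact: stone_cech_base_open.
- exact: stone_cech_embed_dense.
Qed.

(** Principal ultrafilters are isolated points, and a dense set contains every isolated point. *)
Lemma dense_embed (T : Type) (Y : set (stone_cech T)) (t : T) :
  dense Y -> Y (stone_cech_embed t).
Proof.
move=> dY; have [||u [/= ut Yu]] := dY [set stone_cech_embed t].
- by exists (stone_cech_embed t).
- by rewrite -stone_cech_base1; exact: stone_cech_base_open.
- by rewrite -ut.
Qed.

Lemma sub_system_orbit (G : groupType)
    (Y : invariant_open (stone_cech_system G)) : dense Y ->
  exists e : G -> sub_system Y, dense_free_orbit e.
Proof.
move=> dY; pose e g : sub_system Y :=
  exist _ (stone_cech_embed g) (mem_set (dense_embed g dY)).
have [einj eact eopen edense] := stone_cech_orbit G.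
exists e; split.
- by move=> g h /(congr1 \val) /einj.
- by move=> g h; apply: val_inj; exact: eact.
- move=> g; exists [set stone_cech_embed g]; first exact: eopen.
  by apply/seteqP; split=> [y /= yg|_ ->//]; exact: val_inj.
- move=> O' + [O oO eO]; rewrite -eO => -[y Oy].
  have [||u [[Ou Yu] [g _ eg]]] := edense (O `&` Y).
  + by exists (\val y); split=> //; exact: set_valP.
  + by apply: openI => //; exact: invariant_open_open.
  exists (e g); split; last by exists g.
  by change (O (stone_cech_embed g)); rewrite eg.
Qed.

Lemma orbit_couple_swap (G H : groupType) (X : dynamical_system G)
    (Y : dynamical_system H) (p : X -> Y) (q : Y -> X) :
  is_continuous_orbit_couple p q -> is_continuous_orbit_couple q p.
Proof. by case. Qed.

(* The points of the dense orbits are isolated: [q @^-1` [set q (p (eX g))]]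
   is open, so it contains some [eY h], and [p (eX g)] lies in the orbit of
   [p (q (eY h))], hence in that of [eY h]. *)
Lemma orbit_couple_restrict (G H : groupType) (X : dynamical_system G)
    (Y : dynamical_system H) (eX : G -> X) (eY : H -> Y)
    (p : X -> Y) (q : Y -> X) :
  dense_free_orbit eX -> dense_free_orbit eY ->
  is_continuous_orbit_couple p q -> exists phi, forall g, p (eX g) = eY (phi g).
Proof.
move=> [_ aX oX _] [_ aY _ dY] [[_ [a [_ pa]]] [cq _] [c [_ qp]] [d [_ pq]]].
suff /choice[phi pphi] : forall g, exists h, p (eX g) = eY h by exists phi.
move=> g.
have [||y [/= qy [h _ hy]]] := dY (q @^-1` [set eX (c (eX g) * g)]).
- by exists (p (eX g)); rewrite /= qp aX.
- by move/continuousP: cq; apply; exact: oX.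
have := congr1 p qy; rewrite -aX pa -hy pq aY.
move/(congr1 (act (a (c (eX g), eX g))^-1)).
by rewrite -[RHS]actMg mulVg act1g aY => <-; eexists.
Qed.

(** On a compact space the locally constant [c] has finite range. Freeness of the orbit identifies
    its value at [e i] with [f' i * (f i)^-1]. *)
Lemma orbit_close_finite (I : Type) (T : topologicalType) (H : groupType)
    (Y : dynamical_system H) (eY : H -> Y) (e : I -> T) (s s' : T -> Y)
    (f f' : I -> H) :
  dense_free_orbit eY -> compact [set: T] -> orbit_close s s' ->
  s \o e =1 eY \o f -> s' \o e =1 eY \o f' ->
  finite_set [set f' i * (f i)^-1 | i in [set: I]].
Proof.
move=> [ieY aY _ _] cT [c lc sc] sf sf'.
apply: sub_finite_set (compact_locally_constant cT lc) => _ [i _ <-].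
exists (e i) => //; apply: (mulIg (f i)); apply: ieY.
by rewrite mulgVK -aY -[LHS]/(act _ ((eY \o f) i)) -sf -[RHS]sf' /= sc.
Qed.

Section Couple.
Variables (G H : groupType) (X : dynamical_system G) (Y : dynamical_system H).
Variables (eX : G -> X) (eY : H -> Y) (p : X -> Y) (q : Y -> X).
Variables (phi : G -> H) (psi : H -> G).
Hypotheses (dX : dense_free_orbit eX) (dY : dense_free_orbit eY).
Hypothesis cX : compact [set: X].
Hypotheses (pq : is_continuous_orbit_couple p q).
Hypotheses (pphi : forall g, p (eX g) = eY (phi g)).
Hypotheses (qpsi : forall h, q (eY h) = eX (psi h)).

Let orbit_act (Z : topologicalType) (K : groupType) (W : dynamical_system K)
  (s : Z -> W) k : orbit_close s (fun t => act k (s t)).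
Proof. exact: orbit_close_act (locally_constant_cst k). Qed.

Lemma orbit_couple_controlled : controlled phi.
Proof.
have [op _ _ _] := pq; have [_ aX _ _] := dX => k.
apply: (@orbit_close_finite _ X H Y eY eX p (p \o act k)) => //.
  by apply: (orbit_map_close (s := id) op) => [x //|]; exact: (orbit_act id k).
by move=> t; rewrite /= aX pphi.
Qed.

(** The space [Y] may fail to be compact, so the cocycle of [q] may take infinitely many values.
    Composing with [p] moves the comparison to the compact space [X]. *)
Lemma orbit_couple_retract_controlled k :
  finite_set [set psi (k * phi t) * (psi (phi t))^-1 | t in [set: G]].
Proof.
have [[cp _] oq _ _] := pq; have [_ aY _ _] := dY.
apply: (@orbit_close_finite _ X G X eX eX (q \o p) (q \o (act k \o p))) => //.
- by apply: (orbit_map_close oq cp); exact: (orbit_act p k).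
- by move=> t; rewrite /= pphi qpsi.
- by move=> t; rewrite /= pphi aY qpsi.
Qed.

Lemma orbit_couple_close : close_maps (psi \o phi) idfun.
Proof.
have /orbit_coupleP[_ _ qp _] := pq.
apply: (@orbit_close_finite _ X G X eX eX id (q \o p)) => //.
by move=> t; rewrite /= pphi qpsi.
Qed.

Lemma orbit_couple_coarse_embedding : coarse_embedding phi.
Proof.
apply: coarse_embedding_retract orbit_couple_close.
  exact: orbit_couple_controlled.
exact: orbit_couple_retract_controlled.
Qed.

End Couple.

Lemma orbit_couple_coarse_equivalence (G H : groupType)
    (X : dynamical_system G) (Y : dynamical_system H) (eX : G -> X)
    (eY : H -> Y) (p : X -> Y) (q : Y -> X) (phi : G -> H) (psi : H -> G) :
  dense_free_orbit eX -> dense_free_orbit eY ->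
  compact [set: X] -> compact [set: Y] -> is_continuous_orbit_couple p q ->
  (forall g, p (eX g) = eY (phi g)) -> (forall h, q (eY h) = eX (psi h)) ->
  coarse_equivalence phi.
Proof.
move=> dX dY cX cY pq pphi qpsi; have qp := orbit_couple_swap pq.
apply: (@controlled_coarse_equivalence _ _ phi psi).
- exact: (orbit_couple_controlled dX dY cX pq pphi).
- exact: (orbit_couple_controlled dY dX cY qp qpsi).
- exact: (orbit_couple_close dX cX pq pphi qpsi).
- exact: (orbit_couple_close dY cY qp qpsi pphi).
Qed.

(** * Isomorphisms between reductions of transformation groupoids *)

Lemma locally_constant_uncurry (I : choiceType) (T : topologicalType)
    (D : Type) (f : I -> T -> D) : (forall i, locally_constant (f i)) ->
  locally_constant (fun it : discrete_topology I * T => f it.1 it.2).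
Proof.
move=> lf [i t]; exists ([set i], [set t' | f i t' = f i t]) => /=.
  by split; [exact: (@discrete_set1 (discrete_topology I))|exact: lf].
by move=> [i' t'] /= [-> ].
Qed.

Section SubMap.
Context {X Y : topologicalType} {U : set X} {V : set Y}.

Definition sub_map (f : X -> Y) (UV : forall x, U x -> V (f x)) : U -> V :=
  fun u => exist _ (f (\val u)) (mem_set (UV _ (set_valP u))).

Lemma sub_map_continuous f (UV : forall x, U x -> V (f x)) :
  continuous f -> continuous (sub_map UV).
Proof.
move=> cf; apply: continuous_to_set.
exact: continuous_compT (@set_val_continuous _ _) cf.
Qed.

End SubMap.

Lemma sub_map_homeomorphism (X Y : topologicalType) (U : set X) (V : set Y)
    (f : X -> Y) (k : Y -> X) (UV : forall x, U x -> V (f x))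
    (VU : forall y, V y -> U (k y)) :
  continuous f -> continuous k -> {in U, cancel f k} -> {in V, cancel k f} ->
  homeomorphism (sub_map UV).
Proof.
move=> cf ck fK kK; split; first exact: sub_map_continuous.
exists (sub_map VU); split; first exact: sub_map_continuous.
- by move=> u; apply/val_inj/fK/mem_set; exact: set_valP.
- by move=> v; apply/val_inj/kK/mem_set; exact: set_valP.
Qed.

(* [c g x] is the arrow of [Y] at [f x] corresponding to the arrow [g] of [X]
   at [x]. *)
Definition partial_groupoid_map (G H : groupType) (X : dynamical_system G)
    (Y : dynamical_system H) (A : set X) (B : set Y) (f : X -> Y) (k : Y -> X)
    (c : G -> X -> H) (d : H -> Y -> G) :=
  [/\ continuous f, forall g, locally_constant (c g),
      forall x, A x -> B (f x) /\ k (f x) = x &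
      forall g x, A x -> A (act g^-1 x) ->
        act (c g x)^-1 (f x) = f (act g^-1 x) /\ d (c g x) (f x) = g].

Section PartialIso.
Variables (G H : groupType) (X : dynamical_system G) (Y : dynamical_system H).
Variables (A : set X) (B : set Y) (f : X -> Y) (k : Y -> X).
Variables (c : G -> X -> H) (d : H -> Y -> G).

Definition arrow_map (a : transformation_groupoid X) :
  transformation_groupoid Y := (f a.1, c a.2 a.1).

Lemma arrow_map_continuous : partial_groupoid_map A B f k c d ->
  continuous arrow_map.
Proof.
move=> [cf lc _ _]; have c1 := @fst_continuous X (discrete_topology G).
apply: continuous_pair; first exact: continuous_compT c1 cf.
apply/locally_constantP.
have := locally_constant_uncurry lc.
apply: (@locally_constant_preimage (X * discrete_topology G)%type
  (discrete_topology G * X)%type _ _ (fun a => (a.2, a.1))).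
by apply: continuous_pair => //; exact: snd_continuous.
Qed.

Lemma arrow_map_restriction : partial_groupoid_map A B f k c d ->
  forall a, @restriction_arrows (transformation_groupoid X) A a ->
    @restriction_arrows (transformation_groupoid Y) B (arrow_map a).
Proof.
move=> [_ _ AB fc] [x g] [/= sA rA]; split=> /=.
  by rewrite (fc g x rA sA).1; exact: (AB _ sA).1.
exact: (AB _ rA).1.
Qed.

End PartialIso.

(** The two partial maps induce mutually inverse maps of arrows between the reductions, and the
    cocycle identity for [c] is multiplicativity of the first one. *)
Lemma partial_groupoid_iso (G H : groupType) (X : dynamical_system G)
    (Y : dynamical_system H) (A : set X) (B : set Y) (f : X -> Y) (k : Y -> X)
    (c : G -> X -> H) (d : H -> Y -> G) :
  partial_groupoid_map A B f k c d -> partial_groupoid_map B A k f d c ->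
  (forall g g' x, A x -> A (act g^-1 x) -> A (act (g * g')^-1 x) ->
     c (g * g') x = c g x * c g' (act g^-1 x)) ->
  groupoid_isomorphic (@groupoid_restriction (transformation_groupoid X) A)
                      (@groupoid_restriction (transformation_groupoid Y) B).
Proof.
move=> fc kd cM; have [cf lc AB fcE] := fc; have [ck ld BA kdE] := kd.
have AB1 x (Ax : A x) := (AB x Ax).1; have BA1 y (By : B y) := (BA y By).1.
exists (sub_map (arrow_map_restriction fc)), (sub_map AB1); split.
- apply: (sub_map_homeomorphism _ (arrow_map_restriction kd)).
  + exact: arrow_map_continuous fc.
  + exact: arrow_map_continuous kd.
  + move=> [x g] /set_mem[/= sA rA]; rewrite /arrow_map /=.
    by rewrite (AB _ rA).2 (fcE _ _ rA sA).2.
  + move=> [y h] /set_mem[/= sB rB]; rewrite /arrow_map /=.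
    by rewrite (BA _ rB).2 (kdE _ _ rB sB).2.
- apply: (sub_map_homeomorphism _ BA1) => //.
  + by move=> x /set_mem/AB[].
  + by move=> y /set_mem/BA[].
- move=> [[x g] a]; apply: val_inj => /=.
  by have [sA rA] := set_mem a; case: (fcE g x rA sA).
- by move=> [[x g] a]; apply: val_inj.
- move=> [[x g] a] [[x' g'] b] e e'; apply: val_inj; congr pair => /=.
  have [/= sA rA] := set_mem a; have [/= sB rB] := set_mem b.
  have /= ex := congr1 \val e.
  rewrite cM //; first by rewrite ex.
  by rewrite invgM actMg ex.
Qed.

(** * Limits along ultrafilters and limit cocycles *)

Lemma ultrafilter_meet (T : Type) (u : stone_cech T) (A B : set T) :
  ultrafilter_of u A -> ultrafilter_of u B -> exists t, A t /\ B t.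
Proof.
move=> uA uB; suff /filter_ex[t] : ultrafilter_of u (A `&` B) by exists t.
exact: filterI.
Qed.

(** The finite range is compact and discrete, so the image of [u] under [f] is concentrated at one
    point [F u]. Every ultrafilter containing the fibre of [f] over [F u] has the same limit, and
    these form a neighbourhood of [u]. *)
Lemma ultrafilter_limit (T : Type) (D : choiceType) (f : T -> D) :
  finite_set (range f) -> exists2 F : stone_cech T -> D,
    locally_constant F & forall u, ultrafilter_of u (f @^-1` [set F u]).
Proof.
move=> ff.
have /choice[F FP] (u : stone_cech T) :
    exists d, ultrafilter_of u (f @^-1` [set d]).
  have := @finite_compact (discrete_topology D) _ ff.
  rewrite compact_ultra => /(_ _ (ultra_preimage f (ultrafilterP u)))[|d [_ ud]].
    by apply: filterS (@filterT _ (ultrafilter_of u) _) => t _; exists t.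
  by exists d; exact: ud (@discrete_set1 (discrete_topology D) d).
exists F => // u; apply/stone_cech_nbhsP; exists (f @^-1` [set F u]) => // v vu.
by have [t [/= -> ->]] := ultrafilter_meet vu (FP v).
Qed.

Lemma stone_cech_map_agree (T U : Type) (f f' : T -> U) (u : stone_cech T) :
  ultrafilter_of u [set t | f t = f' t] -> stone_cech_map f u = stone_cech_map f' u.
Proof.
move=> ff'; apply/stone_cech_eq/esym/max_filter => A /= uA.
by apply: filterS2 ff' uA => t /= ->.
Qed.

Lemma stone_cech_map_comp (T U V : Type) (f : T -> U) (g : U -> V) u :
  stone_cech_map g (stone_cech_map f u) = stone_cech_map (g \o f) u.
Proof. exact: stone_cech_eq. Qed.

Lemma stone_cech_map_id (T : Type) (u : stone_cech T) : stone_cech_map id u = u.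
Proof. exact: stone_cech_eq. Qed.

Section Saturation.
Variable G : groupType.
Let bG := stone_cech_system G.

Lemma stone_cech_actE (g : G) (u : bG) (A : set G) :
  ultrafilter_of (act g u) A = ultrafilter_of u [set t | A (g * t)].
Proof. by []. Qed.

Lemma stone_cech_base_clopen (T : Type) (A : set T) :
  clopen (stone_cech_base A).
Proof.
split; first exact: stone_cech_base_open.
by rewrite -openC -stone_cech_baseC; exact: stone_cech_base_open.
Qed.

(** Take for [g] the limit along [u] of [t * (sigma t)^-1]. Then [g^-1 * t] equals [sigma t], a
    point of [A], for [u]-almost all [t]. *)
Lemma coarsely_dense_saturation (A : set G) (sigma : G -> G) :
  (forall t, A (sigma t)) ->
  finite_set [set t * (sigma t)^-1 | t in [set: G]] ->
  forall u : bG, exists g, stone_cech_base A (act g^-1 u).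
Proof.
move=> As /ultrafilter_limit[F _ FP] u; exists (F u).
change (ultrafilter_of u [set t | A ((F u)^-1 * t)]).
by apply: filterS (FP u) => t /= <-; rewrite invgM invgK mulgVK.
Qed.

End Saturation.

(* The values of [phi] off [A] and of [psi] off [B] are junk. *)
Definition partial_coarse_map (G H : groupType) (A : set G) (B : set H)
    (phi : G -> H) (psi : H -> G) :=
  (forall t, A t -> B (phi t) /\ psi (phi t) = t) /\
  forall g, finite_set
    [set phi t * (phi (g^-1 * t))^-1 | t in [set t | A t /\ A (g^-1 * t)]].

(** On arrows between points of the closure of [A], [c g u] is the limit along [u] of
    [phi t * (phi (g^-1 * t))^-1]. Elsewhere its value is arbitrary. *)
Definition limit_cocycle (G H : groupType) (A : set G) (phi : G -> H)
    (c : G -> stone_cech_system G -> H) :=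
  (forall g, locally_constant (c g)) /\
  forall g (u : stone_cech_system G),
    stone_cech_base A u -> stone_cech_base A (act g^-1 u) -> ultrafilter_of u
      [set t | [/\ A t, A (g^-1 * t) & phi t = c g u * phi (g^-1 * t)]].

Lemma limit_cocycle_exists (G H : groupType) (A : set G) (phi : G -> H) :
  (forall g, finite_set
    [set phi t * (phi (g^-1 * t))^-1 | t in [set t | A t /\ A (g^-1 * t)]]) ->
  exists c, limit_cocycle A phi c.
Proof.
move=> fphi.
suff /choice[c cP] g : exists c : stone_cech_system G -> H,
    locally_constant c /\ forall u : stone_cech_system G,
    stone_cech_base A u -> stone_cech_base A (act g^-1 u) -> ultrafilter_of u
      [set t | [/\ A t, A (g^-1 * t) & phi t = c u * phi (g^-1 * t)]].
  by exists c; split=> g; have [] := cP g.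
pose D := [set t | A t /\ A (g^-1 * t)].
(* The value 1 off [D] makes the function total while keeping its range finite. *)
pose gam t := if `[< D t >] then phi t * (phi (g^-1 * t))^-1 else 1.
have /ultrafilter_limit[c lc cP] : finite_set (range gam).
  have fin1 : finite_set (1 |` [set phi t * (phi (g^-1 * t))^-1 | t in D]).
    by rewrite finite_setU; split; [exact: finite_set1|exact: fphi].
  apply: sub_finite_set fin1 => _ [t _ <-].
  rewrite /gam; case: asboolP => Dt; last by left.
  by right; exists t.
exists c; split=> // u uA uB.
apply: filterS2 (filterI uA uB) (cP u) => t [/= At gAt].
by rewrite /gam asboolT// => <-; split=> //; rewrite mulgVK.
Qed.

Section LimitCocycle.
Variables (G H : groupType) (A : set G) (B : set H).
Variables (phi : G -> H) (psi : H -> G).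
Let bG := stone_cech_system G.
Let bH := stone_cech_system H.
Variables (c : G -> bG -> H) (d : H -> bH -> G).
Hypothesis AB : partial_coarse_map A B phi psi.
Hypotheses (cphi : limit_cocycle A phi c) (dpsi : limit_cocycle B psi d).
Implicit Types u : bG.

Lemma stone_cech_map_base u :
  stone_cech_base A u -> stone_cech_base B (stone_cech_map phi u).
Proof. by move=> uA; apply: filterS uA => t /AB.1[]. Qed.

Lemma stone_cech_mapK u :
  stone_cech_base A u -> stone_cech_map psi (stone_cech_map phi u) = u.
Proof.
move=> uA; rewrite stone_cech_map_comp -[RHS]stone_cech_map_id.
by apply: stone_cech_map_agree; apply: filterS uA => t /AB.1[].
Qed.

Lemma limit_cocycle_act g u :
  stone_cech_base A u -> stone_cech_base A (act g^-1 u) ->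
  act (c g u)^-1 (stone_cech_map phi u : bH) = stone_cech_map phi (act g^-1 u).
Proof.
move=> uA uB; rewrite [LHS]stone_cech_map_comp [RHS]stone_cech_map_comp.
apply: stone_cech_map_agree.
by apply: filterS (cphi.2 _ _ uA uB) => t [_ _ /= ->]; rewrite mulKg.
Qed.

(** The defining equations of [c] and [d] hold together at some [t]. There they give
    [t = d (c g u) v * (g^-1 * t)], where [v] is the image of [u], and [t] cancels. *)
Lemma limit_cocycleK g u :
  stone_cech_base A u -> stone_cech_base A (act g^-1 u) ->
  d (c g u) (stone_cech_map phi u) = g.
Proof.
move=> uA uB; have uphi := stone_cech_map_base uA.
have := dpsi.2 (c g u) _ uphi; rewrite limit_cocycle_act//.
move=> /(_ (stone_cech_map_base uB)) vd.
have [t [[At gAt e] [_ _ /=]]] := ultrafilter_meet (cphi.2 _ _ uA uB) vd.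
rewrite {2}e mulKg (AB.1 _ At).2 (AB.1 _ gAt).2 => {e}.
by rewrite mulgA -{1}[t]mul1g => /mulIg /esym/divg1_eq.
Qed.

(** The three defining equations hold at a common [t], where the identity is that of the differences
    of [phi] along [t], [g^-1 * t] and [(g * g')^-1 * t]. *)
Lemma limit_cocycleM g g' u : stone_cech_base A u ->
  stone_cech_base A (act g^-1 u) -> stone_cech_base A (act (g * g')^-1 u) ->
  c (g * g') u = c g u * c g' (act g^-1 u).
Proof.
move=> uA ug ugg'; have := cphi.2 g' _ ug; rewrite -actMg -invgM => /(_ ugg').
rewrite stone_cech_actE => ug'.
have [t [[[_ _ e1] [_ _ e2]] [_ _ /= e3]]] :=
  ultrafilter_meet (filterI (cphi.2 _ _ uA ug) (cphi.2 _ _ uA ugg')) ug'.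
by apply: (mulIg (phi ((g * g')^-1 * t))); rewrite -e2 e1 e3 invgM !mulgA.
Qed.

End LimitCocycle.

(** * Kakutani equivalence from coarse maps *)

Section PartialCoarseKakutani.
Variables (G H : groupType) (A : set G) (B : set H).
Variables (phi : G -> H) (psi : H -> G).
Hypothesis AB : partial_coarse_map A B phi psi.
Hypothesis BA : partial_coarse_map B A psi phi.
Let bG := stone_cech_system G.
Let bH := stone_cech_system H.
Variables (Y : dynamical_system H) (j : Y -> bH) (f : bG -> Y).
Hypotheses (cj : continuous j) (injj : injective j) (cf : continuous f).
Hypothesis jM : forall h y, j (act h y) = act h (j y).
Hypothesis jf : forall u, j (f u) = stone_cech_map phi u.
Hypothesis GA : forall u : bG, exists g, stone_cech_base A (act g^-1 u).
Hypothesis HB : forall y : Y, exists h, stone_cech_base B (act h^-1 (j y)).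

(** The injection [j] treats two cases at once: the inclusion of an open subsystem, for coarse
    embeddings, and the identity, for coarse equivalences. *)
Lemma partial_coarse_kakutani : kakutani_equivalent bG Y.
Proof.
have [c cphi] := limit_cocycle_exists AB.2.
have [d dpsi] := limit_cocycle_exists BA.2.
exists (stone_cech_base A), (j @^-1` stone_cech_base B); split.
- exact: stone_cech_base_clopen.
- have [oB cB] := stone_cech_base_clopen B; split.
    by move/continuousP: cj; exact.
  by apply: preimage_closed => // ? _; exact: cj.
- apply/seteqP; split=> // u _; have [g uA] := GA u.
  by exists g => //; exists (act g^-1 u) => //; rewrite -actMg mulgV act1g.
- apply/seteqP; split=> // y _; have [h yB] := HB y.
  exists h => //; exists (act h^-1 y); first by rewrite /= jM.
  by rewrite -actMg mulgV act1g.
apply: (@partial_groupoid_iso G H bG Y _ _ f (stone_cech_map psi \o j) c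
  (fun h y => d h (j y)));
  last by move=> g g' u uA ug ugg'; exact: (limit_cocycleM cphi uA ug ugg').
- split=> //; first exact: cphi.1.
  + move=> u uA; rewrite /= jf; split; first exact: stone_cech_map_base AB _ uA.
    exact: stone_cech_mapK AB _ uA.
  + move=> g u uA ug; split.
      by apply: injj; rewrite jM !jf; exact: limit_cocycle_act cphi _ _ uA ug.
    by rewrite jf; exact: limit_cocycleK AB cphi dpsi _ _ uA ug.
split.
- by apply: continuous_compT cj _; exact: stone_cech_map_continuous.
- by move=> h; apply: locally_constant_preimage cj _; exact: dpsi.1.
- move=> y yB; split; first exact: stone_cech_map_base BA _ yB.
  by apply: injj; rewrite jf; exact: stone_cech_mapK BA _ yB.
- move=> h y yB yh; rewrite /= jM in yh *; split.
    exact: limit_cocycle_act dpsi _ _ yB yh.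
  exact: limit_cocycleK BA dpsi cphi _ _ yB yh.
Qed.

End PartialCoarseKakutani.

Section CoarseEmbeddingKakutani.
Variables (G H : groupType) (phi : G -> H).
Hypothesis ephi : coarse_embedding phi.
Let bG := stone_cech_system G.
Let bH := stone_cech_system H.

Lemma coarse_section : exists (A : set G) (psi : H -> G),
  [/\ partial_coarse_map A (range phi) phi psi,
      partial_coarse_map (range phi) A psi phi &
      forall u : bG, exists g, stone_cech_base A (act g^-1 u)].
Proof.
have /choice[psi phipsi] (h : H) : exists g, range phi h -> phi g = h.
  have [[g _ <-]|nh] := pselect (range phi h); first by exists g.
  by exists 1 => /nh.
have psiK t : phi (psi (phi t)) = phi t by apply: phipsi; exists t.
(* A section [psi] of [phi] over its range selects one point in each fibre; these points form the
   transversal. *)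
exists [set t | psi (phi t) = t], psi; split.
- split=> [t /= At|g]; first by split; [exists t|].
  have /controlledP/(_ g) : forall S, finite_set (differences S) ->
    finite_set (image_differences phi S) by move=> S; case: (ephi S).
  by apply: sub_finite_set => _ [t _ <-]; exists (g^-1 * t); rewrite // mulVKg.
- split=> [_ [t _ <-]|h]; first by rewrite /= !psiK.
  (* All image differences of [S] equal [h], so the embedding property bounds the differences of
     [psi]. *)
  pose S := [set (psi s, psi (h^-1 * s)) |
             s in [set s | range phi s /\ range phi (h^-1 * s)]].
  have /ephi : finite_set (image_differences phi S).
    apply: sub_finite_set (finite_set1 h) => _ [_ [s [Bs hBs] <-] <-] /=.
    by rewrite !phipsi// invgM invgK mulVKg.
  apply: sub_finite_set => _ [s Bs <-].
  by exists (psi s, psi (h^-1 * s)) => //; exists s.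
- apply: (@coarsely_dense_saturation _ _ (psi \o phi)) => [t|].
    by rewrite /= psiK.
  (* The pairs [(t, psi (phi t))] lie in fibres of [phi], so their only image difference is 1, and
     [psi \o phi] is close to the identity. *)
  have /ephi : finite_set (image_differences phi
      [set (t, psi (phi t)) | t in [set: G]]).
    apply: sub_finite_set (finite_set1 1) => _ [_ [t _ <-] <-] /=.
    by rewrite psiK mulgV.
  apply: sub_finite_set => _ [t _ <-].
  by exists (t, psi (phi t)) => //; exists t.
Qed.

Lemma stone_cech_map_range (u : bG) :
  stone_cech_base (range phi) (stone_cech_map phi u).
Proof. by apply: filterS (@filterT _ (ultrafilter_of u) _) => t _; exists t. Qed.

Definition saturation_set : set bH :=
  [set u : bH | exists h, stone_cech_base (range phi) (act h^-1 u)].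

Lemma saturation_set_open : open saturation_set.
Proof.
have -> : saturation_set =
    \bigcup_(h in [set: H]) (@act H bH h^-1 @^-1` stone_cech_base (range phi)).
  by apply/seteqP; split=> u [h] => [uh|_ uh]; exists h.
apply: bigcup_open => h _; move/continuousP: (@act_continuous H bH h^-1).
by apply; exact: stone_cech_base_open.
Qed.

Lemma saturation_set_act k u : saturation_set u -> saturation_set (act k u).
Proof.
by move=> [h uh]; exists (k * h); rewrite -actMg invgM mulgVK.
Qed.

Definition saturation : invariant_open bH :=
  InvariantOpen saturation_set_open saturation_set_act.

Lemma saturation_dense : dense saturation.
Proof.
move=> O nO oO; have [u [Ou [h _ hu]]] := stone_cech_embed_dense nO oO.
(* The inverse of this element carries [h] to [phi 1], a point of the range. *)
exists u; split=> //; exists (h * (phi 1)^-1).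
rewrite -hu stone_cech_system_embed invgM invgK mulgVK.
by apply/principal_filterP; exists 1.
Qed.

Lemma coarse_embedding_kakutani : kakutani_equivalent bG (sub_system saturation).
Proof.
have [A [psi [AB BA GA]]] := coarse_section.
have fsat (u : bG) : saturation_set (stone_cech_map phi u : bH).
  by exists 1; rewrite invg1 act1g; exact: stone_cech_map_range.
pose f (u : bG) : sub_system saturation :=
  exist _ (stone_cech_map phi u : bH) (mem_set (fsat u)).
pose j (y : sub_system saturation) : bH := \val (y : saturation).
apply: (partial_coarse_kakutani AB BA (j := j) (f := f)) => //.
- exact: set_val_continuous.
- by apply: continuous_to_set; exact: stone_cech_map_continuous.
- by move=> y; exact: set_valP y.
Qed.

End CoarseEmbeddingKakutani.

(** Since [phi \o psi'] is close to the identity, the range of [phi] is coarsely dense, so the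
    translates of its closure cover the whole of the compactification. *)
Lemma coarse_equivalence_kakutani (G H : groupType) (phi : G -> H) :
  coarse_equivalence phi ->
  kakutani_equivalent (stone_cech_system G) (stone_cech_system H).
Proof.
move=> ephi; have [A [psi [AB BA GA]]] :=
  coarse_section (coarse_equivalence_embedding ephi).
have [_ [psi' [_ _ phipsi]]] := ephi.
apply: (partial_coarse_kakutani AB BA (j := id) (f := stone_cech_map phi)) => //.
- by move=> y.
- exact: stone_cech_map_continuous.
- apply: (coarsely_dense_saturation (sigma := phi \o psi')) => [t|].
    by exists (psi' t).
  apply: sub_finite_set (finite_image (fun h => h^-1) phipsi) => _ [t _ <-].
  by exists (phi (psi' t) * t^-1); [exists t|rewrite invgM invgK].
Qed.

(** The limit cocycle for the full set [setT] is indexed by the range of an arrow, an orbit cocycle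
    by its source; hence the evaluation at [act g u]. *)
Lemma controlled_orbit_map (G H : groupType) (phi : G -> H) : controlled phi ->
  continuous_orbit_map
    (stone_cech_map phi : stone_cech_system G -> stone_cech_system H).
Proof.
move=> cphi; have [|c cP] := @limit_cocycle_exists G H setT phi.
  move=> g; apply: sub_finite_set (cphi g) => _ [t _ <-].
  by exists (g^-1 * t); rewrite // mulVKg.
apply/orbit_mapP; split; first exact: stone_cech_map_continuous.
exists (fun gu => c gu.1 (act (gu.1 : G) gu.2)).
  apply: (locally_constant_uncurry
    (f := fun g (u : stone_cech_system G) => c g (act g u))) => g.
  by apply: locally_constant_preimage (cP.1 g); exact: act_continuous.
move=> [g u]; pose v : stone_cech_system G := act (g : G) u.
change (stone_cech_map phi v =
  @act H (stone_cech_system H) (c g v) (stone_cech_map phi u)).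
have -> : u = act g^-1 v by rewrite /v -actMg mulVg act1g.
rewrite -(limit_cocycle_act cP); [|exact: filterT..].
by rewrite -actMg mulgV act1g.
Qed.

Lemma bijective_orbit_equivalent (G H : groupType) (phi : G -> H) :
  bijective phi -> coarse_equivalence phi ->
  continuously_orbit_equivalent (stone_cech_system G) (stone_cech_system H).
Proof.
move=> [psi phiK psiK] ephi.
have cphi : controlled phi by apply/controlledP; case: ephi => -[].
have cpsi : controlled psi.
  (* The image of [S'] under [phi] is [S], so the embedding property of [phi] is control of its
     inverse. *)
  apply/controlledP => S fS; pose S' := [set (psi st.1, psi st.2) | st in S].
  have [_] := coarse_equivalence_embedding ephi S'.
  rewrite /differences /image_differences !image_comp; apply.
  by apply: sub_finite_set fS => _ [[s t] St <-] /=; rewrite !psiK; exists (s, t).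
have qp u : stone_cech_map psi (stone_cech_map phi u) = u.
  rewrite stone_cech_map_comp (_ : psi \o phi = id) ?stone_cech_map_id//.
  exact/funext.
have pq u : stone_cech_map phi (stone_cech_map psi u) = u.
  rewrite stone_cech_map_comp (_ : phi \o psi = id) ?stone_cech_map_id//.
  exact/funext.
exists (stone_cech_map phi), (stone_cech_map psi); split=> //.
apply/orbit_coupleP; split; [exact: controlled_orbit_map..| |].
- rewrite (_ : _ \o _ = id); [exact: orbit_close_refl|exact/funext].
- rewrite (_ : _ \o _ = id); [exact: orbit_close_refl|exact/funext].
Qed.

(** * Ranks, enumerations and the flattening of the stabilization *)

Lemma locally_constant_diag (T : topologicalType) (D E : Type) (c : T -> D)
    (F : D -> T -> E) :
  locally_constant c -> (forall d, locally_constant (F d)) ->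
  locally_constant (fun t => F (c t) t).
Proof. by move=> lc lF t; apply: filterS2 (lF (c t) t) (lc t) => t' + ->. Qed.

Section Rank.
Implicit Types v : pred nat.

Lemma rank_inj v j j' : v j -> v j' ->
  count v (iota 0 j) = count v (iota 0 j') -> j = j'.
Proof.
wlog jj' : j j' / (j <= j')%N => [th vj vj' e|].
  by have [|/ltnW] := leqP j j' => /th; [|move=> <-]; auto.
move=> vj _; rewrite -(subnKC jj') iotaD count_cat add0n => /eqP.
rewrite -{1}[count v _]addn0 eqn_add2l.
by case: (j' - j)%N => [_|n /=]; rewrite ?addn0// vj.
Qed.

(** By induction: the least element of [v] has rank 0, and the least one above an element of rank
    [k] has rank [k.+1]. *)
Lemma rank_surj v k : (forall n, exists2 j, (n <= j)%N & v j) ->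
  exists j, v j && (count v (iota 0 j) == k).
Proof.
move=> infv; elim: k => [|k [j /andP[vj /eqP <-]]].
  have exv : exists j, v j by have [j _] := infv 0%N; exists j.
  case: (ex_minnP exv) => j vj minj; exists j; rewrite vj -leqn0 leqNgt.
  rewrite -has_count; apply/hasPn => i; rewrite mem_iota => /= ij.
  by apply: contraL ij => /minj; rewrite -leqNgt.
have exv : exists i, (j < i)%N && v i.
  by have [i ji vi] := infv j.+1; exists i; rewrite ji.
case: (ex_minnP exv) => i /andP[ji vi] mini; exists i; rewrite vi /=.
rewrite -(subnKC ji) iotaD count_cat add0n -addn1 iotaD count_cat /= vj addn0.
rewrite -[X in _ == X]addn1 -[X in _ == X]addn0 eqn_add2l -leqn0 leqNgt.
rewrite -has_count; apply/hasPn => l; rewrite mem_iota => /andP[jl].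
rewrite addn1 subnKC// => li; apply: contraL li => vl; rewrite -leqNgt.
by apply: mini; rewrite vl andbT -addn1.
Qed.

End Rank.

Lemma injective_unbounded (f : nat -> nat) n : injective f ->
  exists i, (n <= f i)%N.
Proof.
move=> injf; apply: contrapT => bf.
have : (size (map f (iota 0 n.+1)) <= size (iota 0 n))%N.
  apply: uniq_leq_size => [|_ /mapP[i _ ->]].
    by rewrite map_inj_uniq ?iota_uniq.
  by rewrite mem_iota ltnNge; apply/negP => nfi; apply: bf; exists i.
by rewrite size_map !size_iota ltnn.
Qed.

(** Listing 1 first gives every point of [A] index 0 in the flattening, so that all points [(n, a)]
    lie over [a]. *)
Lemma countable_enumeration (G : groupType) : countable [set: G] ->
  exists e : nat -> G, e 0%N = 1 /\ forall g, exists i, e i = g.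
Proof.
move=> /countable_injP[c injc].
have /choice[e eP] (i : nat) : exists g, forall g', c g' = i -> g' = g.
  have [[g <-]|nc] := pselect (exists g, c g = i).
    by exists g => g' /injc; apply; rewrite in_setT.
  by exists 1 => g cg; case: nc; exists g.
exists (fun i => if i is i'.+1 then e i' else 1); split=> // g.
by exists (c g).+1; rewrite -(eP _ g).
Qed.

Section Flattening.
Variables (G : groupType) (X : dynamical_system G) (A : set X).
Hypotheses (countableG : countable [set: G]) (clopenA : clopen A).
Hypothesis GA : \bigcup_(g : G) (act g @` A) = [set: X].

(* [Z * X] is cut into the pieces [{n} * {x | index x = i}], each of which is
   moved into [A] by the [i]-th group element; the points of [Z * X] lying over
   a given [a] in [A] are then numbered consecutively. This number depends
   continuously on [a] since infinitely many points lie over each [a], namely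
   all the [(n, a)]. *)
Lemma stabilization_flattening :
  exists (kappa : stabilization X -> nat) (beta : stabilization X -> A)
         (rho : nat -> A -> stabilization X),
    [/\ locally_constant kappa, continuous beta, forall k, continuous (rho k),
        (forall m, rho (kappa m) (beta m) = m) /\
        (forall k a, kappa (rho k a) = k /\ beta (rho k a) = a) &
        orbit_close (snd : stabilization X -> X) (\val \o beta)].
Proof.
have [e [e0 esurj]] := countable_enumeration countableG.
have exA (x : X) : exists i, `[< A (act (e i)^-1 x) >].
  have : [set: X] x by []. rewrite -GA => -[g _ [a Aa <-]].
  by have [i ei] := esurj g; exists i; rewrite ei -actMg mulVg act1g; exact/asboolP.
pose index x := ex_minn (exA x).
have lindex : locally_constant index.
  apply: locally_constant_ex_minn => i.
  apply: (locally_constant_preimage (s := act (e i)^-1)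
    (f := fun x => `[< A x >])).
    exact: act_continuous.
  exact: locally_constant_clopen.
pose base x := act (e (index x))^-1 x.
have lei : locally_constant (fun x => (e (index x))^-1).
  exact: (locally_constant_comp (fun i => (e i)^-1)).
have cbase : continuous base by apply: act_orbit_continuous => // x.
have Abase x : A (base x) by rewrite /base /index; case: ex_minnP => i /asboolP.
have indexA a : A a -> index a = 0%N.
  move=> Aa; rewrite /index; case: ex_minnP => i _ mini; apply/eqP.
  by rewrite -leqn0; apply: mini; rewrite e0 invg1 act1g; exact/asboolP.
(* The code of [(n, i)] stands for the point [(n, act (e i) a)]. Requiring that its index be [i]
   counts each point over [a] once, even if [e] has repetitions. *)
pose valid (a : X) (j : nat) : bool :=
  if (pickle_inv j : option (int * nat)) is Some ni
  then index (act (e ni.2) a) == ni.2 else false.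
pose code (n : int) (i : nat) : nat := pickle (n, i).
have valid_code a n i : valid a (code n i) = (index (act (e i) a) == i).
  by rewrite /valid /code pickleK_inv.
have validP a j : valid a j -> exists n i, j = code n i.
  rewrite /valid; have := @pickle_invK (int * nat)%type j.
  by case: pickle_inv => // -[n i] /= <- _; exists n, i.
have lvalid j : locally_constant (valid^~ j).
  rewrite /valid; case: pickle_inv => [[n i]|]; last exact: locally_constant_cst.
  apply: (locally_constant_comp (fun i' => i' == i)).
  exact: locally_constant_preimage (@act_continuous _ _ _) lindex.
have infvalid (a : A) n : exists2 j, (n <= j)%N & valid (\val a) j.
  have [|i ni] := @injective_unbounded (fun i => code (Posz i) 0%N) n.
    by move=> i i' /(pcan_inj pickleK)[].
  exists (code i 0%N); rewrite // valid_code e0 act1g indexA//.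
  exact: set_valP.
pose exnth k (a : A) := rank_surj k (infvalid a).
pose nth k a := ex_minn (exnth k a).
(* The default value is never reached, as [dec] is applied only to valid numbers, which are
   codes. *)
pose dec j : int * nat := odflt (0%R, 0%N) (pickle_inv j).
have decK n i : dec (code n i) = (n, i) by rewrite /dec /code pickleK_inv.
have lnth k : locally_constant (nth k).
  apply: locally_constant_ex_minn => j.
  apply: (locally_constant_preimage (s := \val : A -> X)
    (f := fun a => valid a j && (count (valid a) (iota 0 j) == k))).
    exact: set_val_continuous.
  apply: locally_constant_comp2; first exact: lvalid.
  apply: (locally_constant_comp (fun l => l == k)).
  exact: locally_constant_count.
have nthP k a : valid (\val a) (nth k a) /\
    count (valid (\val a)) (iota 0 (nth k a)) = k.
  by rewrite /nth; case: ex_minnP => j /andP[vj /eqP].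
pose kappa (m : stabilization X) :=
  count (valid (base m.2)) (iota 0 (code (m.1 : integers) (index m.2))).
pose beta (m : stabilization X) : A := exist _ (base m.2) (mem_set (Abase m.2)).
pose rho k a : stabilization X :=
  ((dec (nth k a)).1 : integers, act (e (dec (nth k a)).2) (\val a)).
exists kappa, beta, rho; split.
- have csnd := @snd_continuous (discrete_topology integers) X.
  apply: (locally_constant_diag
    (c := fun m : stabilization X => code (m.1 : integers) (index m.2))
    (F := fun j m => count (valid (base m.2)) (iota 0 j))).
    apply: (locally_constant_comp2 code).
      by apply/(@locally_constantP _ integers); exact: fst_continuous.
    exact: locally_constant_preimage csnd lindex.
  move=> j; apply: locally_constant_count => i.
  apply: (locally_constant_preimage (s := fun m : stabilization X => base m.2)
    (f := valid^~ i)).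
    exact: continuous_compT csnd cbase.
  exact: lvalid.
- apply: continuous_to_set.
  exact: continuous_compT (@snd_continuous _ _) cbase.
- move=> k; apply: continuous_stab.
    exact: (locally_constant_comp (fun j => (dec j).1)).
  apply: (act_orbit_continuous (s := \val : A -> X)
    (c := fun a => e (dec (nth k a)).2)).
    exact: (locally_constant_comp (fun j => e (dec j).2)).
  exact: set_val_continuous.
- have baseK x : act (e (index x)) (base x) = x.
    by rewrite /base -actMg mulgV act1g.
  split=> [[n x]|k a].
    have -> : rho (kappa (n, x)) (beta (n, x)) =
        ((dec (code n (index x))).1 : integers,
         act (e (dec (code n (index x))).2) (base x)).
      have [vn cn] := nthP (kappa (n, x)) (beta (n, x)).
      (* A valid number is determined by its rank, so the one selected by [nth] is the code of
         [(n, x)]. *)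
      rewrite /rho -(rank_inj _ vn (esym cn)) //.
      by rewrite /= valid_code baseK.
    by rewrite decK /= baseK.
  have [vn cn] := nthP k a; have [n [i ni]] := validP _ _ vn.
  rewrite /rho ni decK; move: vn cn; rewrite ni valid_code => /eqP ie cn.
  have be : base (act (e i) (\val a)) = \val a.
    by rewrite /base ie -actMg mulVg act1g.
  by split; [rewrite /kappa /= be ie|apply: val_inj].
- exists (fun m => (e (index m.2))^-1) => //.
  exact: locally_constant_preimage (@snd_continuous _ _) lei.
Qed.

End Flattening.

(** * From Kakutani equivalence to stable orbit equivalence *)

Local Notation reduction X A :=
  (@groupoid_restriction (transformation_groupoid X) A).

Section KakutaniStable.

(** The arrow with range [s' t] and group coordinate [c t] has source [s t]. The group coordinate of
    its image under [f] moves [f0 (s t)] to [f0 (s' t)] and depends continuously on [t]. *)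
Let reduction_map_close (G H : groupType) (X : dynamical_system G)
  (Y : dynamical_system H) (A : set X) (B : set Y)
  (f : reduction X A ->
       reduction Y B)
  (f0 : A -> B) : continuous f ->
  (forall a, gsrc (f a) = f0 (gsrc a)) ->
  (forall a, grng (f a) = f0 (grng a)) ->
  forall (T : topologicalType) (s s' : T -> A), continuous s' ->
  orbit_close (\val \o s) (\val \o s') ->
  orbit_close (\val \o (f0 \o s)) (\val \o (f0 \o s')).
Proof.
move=> cf fsrc frng T s s' cs' [c lc sc].
pose alpha t : transformation_groupoid X := (\val (s' t), c t).
have srcE t : gsrc (alpha t) = \val (s t).
  by have /= e := sc t; rewrite /= e -actMg mulVg act1g.
have alphaA t : @restriction_arrows (transformation_groupoid X) A (alpha t).
  split; last exact: set_valP (s' t).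
  by change (A (gsrc (alpha t))); rewrite srcE; exact: set_valP.
pose beta t : reduction X A :=
  exist _ (alpha t) (mem_set (alphaA t)).
have cbeta : continuous beta.
  apply: continuous_to_set; apply: continuous_pair; last exact/locally_constantP.
  exact: continuous_compT cs' (@set_val_continuous _ _).
pose d t : H := (\val (f (beta t)) : transformation_groupoid Y).2.
exists d.
  apply/locally_constantP; apply: continuous_compT (@snd_continuous _ _).
  apply: continuous_compT (@set_val_continuous _ _).
  exact: continuous_compT cbeta cf.
move=> t.
have st : gsrc (beta t) = s t by apply: val_inj; exact: srcE.
have s't : grng (beta t) = s' t by exact: val_inj.
rewrite /= -st -s't -fsrc -frng /=.
by rewrite -actMg mulgV act1g.
Qed.

Let flattened_orbit_map (G H : groupType) (X : dynamical_system G)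
  (Y : dynamical_system H) (A : set X) (B : set Y)
  (kX : stabilization X -> nat) (bX : stabilization X -> A)
  (bY : stabilization Y -> B) (rY : nat -> B -> stabilization Y)
  (f : reduction X A -> reduction Y B) (f0 : A -> B) :
  locally_constant kX -> continuous bX -> (forall k, continuous (rY k)) ->
  (forall k b, bY (rY k b) = b) ->
  orbit_close (snd : stabilization X -> X) (\val \o bX) ->
  orbit_close (snd : stabilization Y -> Y) (\val \o bY) ->
  continuous f -> continuous f0 ->
  (forall a, gsrc (f a) = f0 (gsrc a)) ->
  (forall a, grng (f a) = f0 (grng a)) ->
  continuous_orbit_map (fun m => rY (kX m) (f0 (bX m))).
Proof.
move=> lkX cbX crY rYK closeX closeY cf cf0 fsrc frng.
pose p m := rY (kX m) (f0 (bX m)).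
have cp : continuous p.
  apply: (locally_constant_glue (F := fun k m => rY k (f0 (bX m)))) => // k.
  by apply: continuous_compT (crY k); exact: continuous_compT cbX cf0.
apply/orbit_mapP; split=> //.
pose T := (discrete_topology (integers * G)%type * stabilization X)%type.
pose s (t : T) := act (t.1 : (integers * G)%type) t.2.
have csnd : continuous (snd : T -> stabilization X) by exact: snd_continuous.
have lfst : locally_constant (fst : T -> (integers * G)%type).
  by apply/locally_constantP; exact: fst_continuous.
have cs : continuous s by exact: act_orbit_continuous.
apply: orbit_close_stab.
- exact: continuous_compT csnd cp.
- exact: continuous_compT cs cp.
(* Up to the action, [p] is [f0] on base points. What remains is to compare the base points before
   and after acting, which lie in one orbit. *)
have p_close (u : T -> stabilization X) : continuous u ->
    orbit_close (fun t => (p (u t)).2 : Y) (\val \o (f0 \o (bX \o u))).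
  move=> cu; have := orbit_close_comp (continuous_compT cu cp) closeY.
  by congr orbit_close; apply/funext => t /=; rewrite /p rYK.
apply: orbit_close_trans (p_close _ csnd) _.
apply: orbit_close_trans (orbit_close_sym (p_close _ cs)).
apply: reduction_map_close cf fsrc frng _ _ _ _ _.
  exact: continuous_compT cs cbX.
apply: orbit_close_trans (orbit_close_comp cs closeX).
apply: orbit_close_trans (orbit_close_sym (orbit_close_comp csnd closeX)) _.
by apply: orbit_close_snd; exact: orbit_close_act.
Qed.

(** Both stabilizations flatten to products of the natural numbers with [A] and [B]; the equivalence
    keeps the number and applies [f0] to the base point. *)
Lemma kakutani_stable (G H : groupType) (X : dynamical_system G)
    (Y : dynamical_system H) :
  countable [set: G] -> countable [set: H] -> kakutani_equivalent X Y ->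
  stably_continuously_orbit_equivalent X Y.
Proof.
move=> cG cH [A [B [clA clB GA HB]]].
move=> [f [f0 [[cf [f' [cf' fK f'K]]] [cf0 [f0' [cf0' f0K f0'K]]] fsrc frng _]]].
have [kX [bX [rX [lkX cbX crX [rkX krX] closeX]]]] :=
  stabilization_flattening cG clA GA.
have [kY [bY [rY [lkY cbY crY [rkY krY] closeY]]]] :=
  stabilization_flattening cH clB HB.
have f'src b : gsrc (f' b) = f0' (gsrc b) by rewrite -{2}[b]f'K fsrc f0K.
have f'rng b : grng (f' b) = f0' (grng b) by rewrite -{2}[b]f'K frng f0K.
pose p m := rY (kX m) (f0 (bX m)); pose q m := rX (kY m) (f0' (bY m)).
have pK : cancel p q.
  by move=> m; rewrite /p /q (krY _ _).1 (krY _ _).2 f0K rkX.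
have qK : cancel q p.
  by move=> m; rewrite /p /q (krX _ _).1 (krX _ _).2 f0'K rkY.
exists p, q; split=> //; apply/orbit_coupleP; split.
- apply: (@flattened_orbit_map G H X Y A B kX bX bY rY f f0) => // k b.
  exact: (krY k b).2.
- apply: (@flattened_orbit_map H G Y X B A kY bY bX rX f' f0') => // k a.
  exact: (krX k a).2.
- by rewrite (_ : q \o p = id); [exact: orbit_close_refl|exact/funext].
- by rewrite (_ : p \o q = id); [exact: orbit_close_refl|exact/funext].
Qed.

End KakutaniStable.

(** * The three parts of the equivalence *)

Theorem corollary2p21 (G H : groupType)
    (countableG : countable [set: G]) (countableH : countable [set: H]) :
  let bG := stone_cech_system G in
  let bH := stone_cech_system H in
  [/\ [<-> exists phi : G -> H, coarse_embedding phi;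
           exists Y : invariant_open bH,
             dense Y /\ kakutani_equivalent bG (sub_system Y);
           exists Y : invariant_open bH,
             dense Y /\ has_continuous_orbit_couple bG (sub_system Y);
           exists Y : invariant_open bH,
             dense Y /\ stably_continuously_orbit_equivalent bG (sub_system Y)],
      [/\ (exists phi : G -> H, coarse_equivalence phi) <->
             kakutani_equivalent bG bH,
          (exists phi : G -> H, coarse_equivalence phi) <->
             has_continuous_orbit_couple bG bH &
          (exists phi : G -> H, coarse_equivalence phi) <->
             stably_continuously_orbit_equivalent bG bH] &
      (exists phi : G -> H, bijective phi /\ coarse_equivalence phi) <->
        continuously_orbit_equivalent bG bH].
Proof.
move=> bG bH.
have eG := stone_cech_orbit G; have eH := stone_cech_orbit H.
have cG : compact [set: bG] by exact: stone_cech_compact.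
have cH : compact [set: bH] by exact: stone_cech_compact.
have kak_stab (Y : dynamical_system H) :=
  @kakutani_stable G H bG Y countableG countableH.
have stab_couple (Y : dynamical_system H) := @stable_orbit_couple G H bG Y.
have emb_kak : (exists phi : G -> H, coarse_embedding phi) ->
    exists Y : invariant_open bH, dense Y /\ kakutani_equivalent bG (sub_system Y).
  move=> [phi ephi]; exists (saturation phi).
  by split; [exact: saturation_dense|exact: coarse_embedding_kakutani].
have couple_emb (Y : invariant_open bH) : dense Y ->
    has_continuous_orbit_couple bG (sub_system Y) ->
    exists phi : G -> H, coarse_embedding phi.
  move=> dY [p [q pq]]; have [e eY] := sub_system_orbit dY.
  have [phi pphi] := orbit_couple_restrict eG eY pq.
  have [psi qpsi] := orbit_couple_restrict eY eG (orbit_couple_swap pq).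
  by exists phi; exact: orbit_couple_coarse_embedding eG eY cG pq pphi qpsi.
have equiv_kak : (exists phi : G -> H, coarse_equivalence phi) ->
    kakutani_equivalent bG bH.
  by move=> [phi]; exact: coarse_equivalence_kakutani.
have couple_equiv (p : bG -> bH) (q : bH -> bG) :
    is_continuous_orbit_couple p q -> exists phi psi,
    [/\ forall g, p (stone_cech_embed g) = stone_cech_embed (phi g),
        forall h, q (stone_cech_embed h) = stone_cech_embed (psi h) &
        coarse_equivalence phi].
  move=> pq; have [phi pphi] := orbit_couple_restrict eG eH pq.
  have [psi qpsi] := orbit_couple_restrict eH eG (orbit_couple_swap pq).
  exists phi, psi; split=> //.
  exact: orbit_couple_coarse_equivalence eG eH cG cH pq pphi qpsi.
have couple_equivalence : has_continuous_orbit_couple bG bH ->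
    exists phi : G -> H, coarse_equivalence phi.
  by move=> [p [q /couple_equiv[phi [psi []]]]]; exists phi.
split.
- tfae.
  + exact: emb_kak.
  + by move=> [Y [dY /kak_stab/stab_couple]]; exists Y.
  (* The subspace changes here: the couple yields a coarse embedding, and [Z] is the subspace
     obtained from that embedding. *)
  + by move=> [Y [dY /(couple_emb Y dY)/emb_kak[Z [dZ /kak_stab]]]]; exists Z.
  + by move=> [Y [dY /stab_couple/(couple_emb Y dY)]].
- split; split.
  + exact: equiv_kak.
  + by move=> /kak_stab/stab_couple.
  + by move=> /equiv_kak/kak_stab/stab_couple.
  + exact: couple_equivalence.
  + by move=> /equiv_kak/kak_stab.
  + by move=> /stab_couple.
split=> [[phi [bphi ephi]]|]; first exact: bijective_orbit_equivalent bphi ephi.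
move=> [p [q [/couple_equiv[phi [psi [pphi qpsi ephi]]] pK qK]]].
(* Since [p] and [q] are inverse to each other, so are their restrictions to the embedded groups. *)
exists phi; split=> //; exists psi => [g|h]; apply: stone_cech_embed_inj.
  by rewrite -qpsi -pphi.
by rewrite -pphi -qpsi.
Qed.
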